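(* Let $a,b,q,p$ be complex parameters with $a,b,q\neq 0$ and $|p|<1$ (generic, so that no denominator below vanishes). Let $l,k,n,m$ be four integers with $n-l+m-k\ge 0$. The elliptic generating function of lattice paths running from $(l,k)$ to $(n,m)$ is $$ \begin{aligned} w(\mathcal P((l,k)\to(n,m)))={}& \frac{(q^{1+n-l},aq^{1+n+2k},bq^{1+n+k+l},aq^{1+k-n}/b;q,p)_{m-k}} {(q,aq^{1+l+2k},bq^{1+2n+k},aq^{1+k-l}/b;q,p)_{m-k}}\\ &\times \frac{(aq^{1+l+2k},aq^{1-n}/b,aq^{-n}/b;q,p)_{n-l}} {(aq^{1+l},aq^{1+k-n}/b,aq^{k-n}/b;q,p)_{n-l}}\; \frac{(bq^{1+2l};q,p)_{2n-2l}}{(bq^{1+k+2l};q,p)_{2n-2l}}\;q^{(n-l)k}. \end{aligned} $$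
   Context: Theta functions: for $x\ne0$, $|p|<1$, $\theta(x)=\theta(x;p):=(x;p)_\infty(p/x;p)_\infty$ with $(x;p)_\infty=\prod_{k=0}^\infty(1-xp^k)$, and $\theta(x_1,\dots,x_s)=\prod_{i=1}^s\theta(x_i)$. Theta shifted factorials: for every integer $n$, $(a;q,p)_n=\prod_{k=0}^{n-1}\theta(aq^k)$ if $n\ge1$, $(a;q,p)_0=1$, and $(a;q,p)_n=1/\prod_{k=0}^{-n-1}\theta(aq^{n+k})$ if $n\le-1$; and $(a_1,\dots,a_s;q,p)_n=\prod_{i=1}^s(a_i;q,p)_n$. (A factor $1/(q;q,p)_{n}$ with $n<0$ is a product of theta values containing $\theta(1)=0$, hence equals $0$.) Lattice paths: paths in $\mathbb Z^2$ consisting of unit horizontal steps $(x-1,y)\to(x,y)$ and unit vertical steps $(x,y-1)\to(x,y)$ in the positive direction; the path with no steps from a point to itself is allowed. $\mathcal P(u\to v)$ is the (finite, possibly empty) set of all lattice paths from $u$ to $v$. Weights: the horizontal edge $(n-1,m)\to(n,m)$ has the elliptic weight $$w(n,m)=w(n,m;a,b;q,p):=\frac{\theta(aq^{n+2m},bq^{2n},bq^{2n-1},aq^{1-n}/b,aq^{-n}/b)}{\theta(aq^n,bq^{2n+m},bq^{2n+m-1},aq^{1+m-n}/b,aq^{m-n}/b)}\,q^m .$$ The weight $w(P)$ of a path $P$ is the product of the weights of its horizontal steps (empty product $=1$). For a finite set $\mathcal M$ of paths, $w(\mathcal M):=\sum_{P\in\mathcal M}w(P)$ (so $w(\emptyset)=0$);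 this is the elliptic generating function of $\mathcal M$. *)

(* Defs.v *)
From mathcomp Require Import all_boot all_order all_algebra complex.
From mathcomp Require Import all_classical all_reals all_analysis.

Set Implicit Arguments.
Unset Strict Implicit.
Unset Printing Implicit Defensive.

Import Order.TTheory GRing.Theory Num.Theory numFieldNormedType.Exports.

Local Open Scope classical_set_scope.
Local Open Scope ring_scope.

Section Theta.
(* The analytic notions are stated over an arbitrary numFieldType, which carries
   the topology of its norm; they are meant to be used with C := R[i]. *)
Variable C : numFieldType.
Implicit Types (a b q p x : C) (n m : int).

(* (x; p)_oo, meaningful for `|p| < 1. *)
Definition qpoch_inf p x : C :=
  lim ((\prod_(0 <= k < N) (1 - x * p ^+ k)) @[N --> \oo]).

(* theta(x; p), meaningful for x != 0 and `|p| < 1. *)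
Definition theta p x : C := qpoch_inf p x * qpoch_inf p (p / x).

Definition thetas p (s : seq C) : C := \prod_(x <- s) theta p x.

(* (a; q, p)_n for an arbitrary integer n. Note that Negz j is - (j + 1), so
   that the product in the second case has - n factors. Since 0^-1 = 0, for
   n < 0 the inverse of (a; q, p)_n is always the product of these factors; in
   particular (q; q, p)_n^-1 = 0, because theta p 1 = 0 is one of them. *)
Definition tfact q p a n : C :=
  match n with
  | Posz j => \prod_(0 <= i < j) theta p (a * q ^+ i)
  | Negz j => (\prod_(0 <= i < j.+1) theta p (a * q ^ (n + i%:Z)))^-1
  end.

Definition tfacts q p (s : seq C) n : C := \prod_(a <- s) tfact q p a n.

Definition weight_den a b q p n m : C :=
  thetas p [:: a * q ^ n; b * q ^ (2 * n + m); b * q ^ (2 * n + m - 1);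
               a * q ^ (1 + m - n) / b; a * q ^ (m - n) / b].

(* Weight of the horizontal edge (n - 1, m) -> (n, m). *)
Definition weight a b q p n m : C :=
  thetas p [:: a * q ^ (n + 2 * m); b * q ^ (2 * n); b * q ^ (2 * n - 1);
               a * q ^ (1 - n) / b; a * q ^ (- n) / b]
  / weight_den a b q p n m * q ^ m.

End Theta.

Section LatticePaths.
Implicit Types (u v : int * int) (P : seq (int * int)).

Definition hstep u v := (v.1 == u.1 + 1) && (v.2 == u.2).
Definition vstep u v := (v.1 == u.1) && (v.2 == u.2 + 1).

(* A lattice path is given by the list of all the vertices it visits, including
   both endpoints; the path with no steps from u to u is [:: u]. *)
Definition lattice_paths u v : set (seq (int * int)) :=
  [set P | if P is x :: s then
             [&& x == u, path (fun y z => hstep y z || vstep y z) x s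
               & last x s == v]
           else false].

Variable C : numFieldType.
Implicit Types (a b q p : C).

(* zip P (behead P) lists the steps (y, z) of P. *)
Definition path_weight a b q p P : C :=
  \prod_(e <- zip P (behead P) | hstep e.1 e.2) weight a b q p e.2.1 e.2.2.

(* The elliptic generating function w(M), for a finite set M of paths. *)
Definition paths_weight a b q p (M : set (seq (int * int))) : C :=
  \sum_(P \in M) path_weight a b q p P.

End LatticePaths.

(* Main.v *)
Require Import Defs.
From mathcomp Require Import all_boot all_order all_algebra complex.
From mathcomp Require Import all_classical all_reals all_analysis.
From mathcomp Require Import ring lra zify.

Import Order.TTheory GRing.Theory Num.Theory numFieldNormedType.Exports.

Local Open Scope classical_set_scope.
Local Open Scope ring_scope.
Local Open Scope complex_scope.

Set Implicit Arguments.
Unset Strict Implicit.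
Unset Printing Implicit Defensive.

(** The path sum W(n, m) is determined by the recurrence
      W(n, m) = W(n - 1, m) w(n, m) + W(n, m - 1),
    which sorts the paths by their last step, together with W(l, k) = 1 and the
    vanishing of W to the left of and below the starting point. The closed form is
    shown to satisfy the same conditions ([closed_form0n], [closed_formS0],
    [closed_formSS]); for n < l or m < k it vanishes because of a factor
    theta(1) = 0. Dividing the recurrence of the closed form by the common factor
    of its three terms leaves an identity between products of four theta values:
    Weierstrass' addition formula.

    The addition formula ([theta_weierstrass]) is proved from series. By Jacobi's
    triple product, theta(s) theta(t) is a constant times the sum over all integers
    i, j of
      p^(i (i - 1) / 2 + j (j - 1) / 2) (- s)^i (- t)^j.
    In the coordinates i + j and i - j the exponent of p separates, and splitting by
    the parity of i + j gives
      theta(s) theta(t) = const (A(st) B(s/t) - t B(st) A(s/t)),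
    where A(z) is the sum of the p^(k (k - 1)) z^k and B(z) that of the p^(k^2) z^k.
    Since A(1/z) = A(z) / z and B(1/z) = B(z), such products are 2x2 minors
    of a matrix with two rows, and the addition formula is the Pluecker relation.

    The limits are organised so that only finite sums occur. The finite form of the
    triple product ([finite_triple_product]) and truncated versions of A and B are
    compared by a dominated convergence theorem for sums over arbitrary finite index
    sets ([cvg_sum_exhausting]); the Pluecker relation already holds for the
    truncations ([theta_pair_identity]), and it passes to the limit. The value p = 0,
    where theta(x) = 1 - x, is treated apart. *)

(** * Limits and infinite products of complex numbers *)

Local Notation normc := ComplexField.Normc.normc.

Section ComplexLimits.
Variable R : realType.
Local Notation C := (R[i] : numFieldType).
Implicit Types (z w l : C) (u v : nat -> C).

Lemma normc_ge0 z : 0 <= normc z.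
Proof. by case: z => x y /=; exact: sqrtr_ge0. Qed.

Lemma normC_normc z : `|z| = (normc z)%:C.
Proof. by rewrite normc_def; case: z. Qed.

Lemma normc_sum (T : Type) (s : seq T) (f : T -> C) :
  normc (\sum_(x <- s) f x) <= \sum_(x <- s) normc (f x).
Proof.
elim: s => [|x s IH]; first by rewrite !big_nil ComplexField.Normc.normc0.
by rewrite !big_cons (le_trans (le_normcD _ _))// lerD2l.
Qed.

Lemma normcX z n : normc (z ^+ n) = normc z ^+ n.
Proof.
elim: n => [|n IH]; first by rewrite !expr0 ComplexField.Normc.normc1.
by rewrite !exprS ComplexField.Normc.normcM IH.
Qed.

Lemma cvg_normcP u l :
  u n @[n --> \oo] --> l <-> normc (l - u n) @[n --> \oo] --> (0 : R).
Proof.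
rewrite cvgrPdist_lt; split.
  move=> H; apply/cvgrPdist_lt => e e0.
  have e0' : (0 : C) < e%:C by rewrite ltcR.
  have := H _ e0'; apply: filterS => n.
  by rewrite normC_normc ltcR sub0r normrN ger0_norm ?normc_ge0.
move=> /cvgrPdist_lt H e e0.
have eR : e = (complex.Re e)%:C by rewrite RRe_real// gtr0_real.
have e0' : (0 : R) < complex.Re e by rewrite -ltcR -eR.
have := H _ e0'; apply: filterS => n.
by rewrite sub0r normrN ger0_norm ?normc_ge0// eR normC_normc ltcR.
Qed.

Lemma normc_le_Re_Im z : normc z <= `|complex.Re z| + `|complex.Im z|.
Proof.
case: z => x y /=.
rewrite -[leRHS]ger0_norm ?addr_ge0// -sqrtr_sqr ler_wsqrtr// sqrrD.
rewrite !real_normK ?num_real// addrAC lerDl mulrn_wge0// mulr_ge0//.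
Qed.

Lemma Re_le_normc z : `|complex.Re z| <= normc z.
Proof.
by case: z => x y /=; rewrite -sqrtr_sqr ler_wsqrtr// lerDl sqr_ge0.
Qed.

Lemma Im_le_normc z : `|complex.Im z| <= normc z.
Proof.
by case: z => x y /=; rewrite -sqrtr_sqr ler_wsqrtr// lerDr sqr_ge0.
Qed.

(** Completeness of the complex numbers reduces to that of the real line, one
    coordinate at a time. *)
Lemma cvgc_Re_Im u : cvgn (fun n => complex.Re (u n)) ->
  cvgn (fun n => complex.Im (u n)) -> cvgn u.
Proof.
set x := fun n => _; set y := fun n => _ => /cvg_ex[a xa] /cvg_ex[b yb].
apply/cvg_ex; exists (a +i* b); apply/cvg_normcP.
apply: (@squeeze_cvgr _ _ _ _ (cst 0) (fun n => `|a - x n| + `|b - y n|)).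
- near=> n; rewrite normc_ge0 (le_trans (normc_le_Re_Im _))//.
  by rewrite /x /y; case: (u n).
- exact: cvg_cst.
- rewrite -[X in _ --> X](_ : `|a - a| + `|b - b| = 0); last first.
    by rewrite !subrr normr0 addr0.
  by apply: cvgD; apply: cvg_norm; apply: cvgB => //; exact: cvg_cst.
Unshelve. all: by end_near.
Qed.

Lemma cvg_geometric_increments (x : nat -> R) (A r : R) : 0 <= r < 1 ->
  (forall n, `|x n.+1 - x n| <= A * r ^+ n) -> cvgn x.
Proof.
move=> /andP[r0 r1] xA.
have A0 : 0 <= A by have := xA 0%N; rewrite expr0 mulr1; apply: le_trans.
have cs : cvgn (series (telescope x)).
  apply: normed_cvg; apply: (@series_le_cvg _ _ (geometric A r)).
  - by move=> n; exact: normr_ge0.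
  - by move=> n /=; rewrite mulr_ge0// exprn_ge0.
  - by move=> n /=; exact: xA.
  - by apply: is_cvg_geometric_series; rewrite ger0_norm.
rewrite (_ : x = fun n => x 0%N + series (telescope x) n); last first.
  by apply/funext => n; rewrite -eq_sum_telescope.
by apply: is_cvgD => //; exact: is_cvg_cst.
Qed.

(** The partial products stay below exp (A / (1 - r)), so consecutive ones differ
    by a geometrically small amount. *)
Lemma cvgn_prod1D (a : nat -> C) (A r : R) : 0 <= r < 1 ->
  (forall n, normc (a n) <= A * r ^+ n) ->
  cvgn (fun N => \prod_(0 <= k < N) (1 + a k)).
Proof.
move=> /andP[r0 r1] aA.
have A0 : 0 <= A.
  by have := aA 0%N; rewrite expr0 mulr1; apply: le_trans; exact: normc_ge0.
set z := fun N => _.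
have zK N : normc (z N) <= expR (A / (1 - r)).
  apply: (@le_trans _ _ (expR (\sum_(0 <= k < N) A * r ^+ k))).
    rewrite /z; elim: N => [|N IH].
      by rewrite !big_nil expR0 ComplexField.Normc.normc1.
    rewrite !big_nat_recr//= ComplexField.Normc.normcM expRD ler_pM ?normc_ge0//.
    apply: le_trans (expR_ge1Dx _).
    by rewrite (le_trans (le_normcD _ _))// ComplexField.Normc.normc1 lerD2l.
  rewrite ler_expR -mulr_sumr ler_wpM2l//.
  rewrite -[leRHS]mul1r ler_pdivlMr ?subr_gt0//.
  have := geometric_seriesE 1 (negbT (lt_eqF r1)) => /(congr1 (fun f => f N)) /=.
  rewrite /series/= (eq_bigr (fun k => r ^+ k)) => [->|k _]; last by rewrite mul1r.
  by rewrite mul1r divfK ?subr_eq0 ?(gt_eqF r1)// gerBl exprn_ge0.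
have dz N : normc (z N.+1 - z N) <= expR (A / (1 - r)) * A * r ^+ N.
  rewrite /z big_nat_recr//= mulrDr mulr1 addrC addrA addNr add0r.
  rewrite ComplexField.Normc.normcM -mulrA ler_pM ?normc_ge0//; exact: zK.
have rr : 0 <= r < 1 by rewrite r0.
apply: cvgc_Re_Im.
  apply: (@cvg_geometric_increments _ (expR (A / (1 - r)) * A) r rr) => N.
  by apply: le_trans (dz N); rewrite -raddfB; exact: Re_le_normc.
apply: (@cvg_geometric_increments _ (expR (A / (1 - r)) * A) r rr) => N.
by apply: le_trans (dz N); rewrite -raddfB; exact: Im_le_normc.
Qed.

Lemma cvgc_unique u l l' :
  u n @[n --> \oo] --> l -> u n @[n --> \oo] --> l' -> l = l'.
Proof. exact: (cvg_unique (@norm_hausdorff _ _)). Qed.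

Lemma cvgc_eventually_cst u l w :
  u n @[n --> \oo] --> l -> (forall n, u n.+1 = w) -> l = w.
Proof.
move=> ul uw; apply: (cvgc_unique ul); apply: cvg_near_cst.
by exists 1%N => // -[//|n] _; exact: uw.
Qed.

End ComplexLimits.

(** * Dominated convergence for sums over finite index sets *)

Section FiniteSums.
Variable R : realType.
Local Notation C := (R[i] : numFieldType).

Definition bounded_sums (T : eqType) (g : T -> R) :=
  exists B, forall s : seq T, uniq s -> \sum_(x <- s) g x <= B.

Lemma big_uniq_sub (V : nmodType) (T : eqType) (g : T -> V) (s t : seq T) :
  uniq s -> uniq t -> {subset s <= t} ->
  \sum_(x <- s) g x = \sum_(x <- t | x \in s) g x.
Proof.
move=> us ut st; rewrite -[RHS]big_filter; apply: perm_big.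
apply: uniq_perm; rewrite ?filter_uniq// => x.
by rewrite mem_filter; case: (boolP (x \in s)) => //= /st ->.
Qed.

Lemma ler_sum_uniq_sub (T : eqType) (g : T -> R) (s t : seq T) :
  (forall x, 0 <= g x) -> uniq s -> uniq t -> {subset s <= t} ->
  \sum_(x <- s) g x <= \sum_(x <- t) g x.
Proof.
move=> g0 us ut st; rewrite (big_uniq_sub g us ut st).
by rewrite [leRHS](bigID (mem s))/= lerDl sumr_ge0.
Qed.

Lemma bounded_sums_mul (S T : eqType) (g : S -> R) (h : T -> R) :
  (forall x, 0 <= g x) -> (forall y, 0 <= h y) ->
  bounded_sums g -> bounded_sums h -> bounded_sums (fun x : S * T => g x.1 * h x.2).
Proof.
move=> g0 h0 [B gB] [D hD]; exists (B * D) => s us.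
pose s1 := undup [seq x.1 | x <- s]; pose s2 := undup [seq x.2 | x <- s].
apply: (@le_trans _ _ (\sum_(x <- [seq (i, j) | i <- s1, j <- s2]) g x.1 * h x.2)).
  apply: ler_sum_uniq_sub => //.
  - by move=> x; rewrite mulr_ge0.
  - by rewrite allpairs_uniq ?undup_uniq// => -[? ?] [].
  - move=> [i j] ij; apply/allpairsP; exists (i, j) => /=.
    by split=> //; rewrite mem_undup; apply/mapP; exists (i, j).
rewrite big_allpairs /=; under eq_bigr do rewrite -mulr_sumr.
by rewrite -mulr_suml ler_pM ?sumr_ge0 ?gB ?hD ?undup_uniq.
Qed.

(** Dominated convergence for sums along arbitrary finite index sets. Summability
    leaves a finite set outside which every partial sum is small; on that set
    pointwise convergence suffices. *)
Lemma tannery_to0 (T : eqType) (g : T -> R) (h : nat -> T -> R) (K : R)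
    (L : nat -> seq T) :
  (forall x, 0 <= g x) -> bounded_sums g -> (forall n, uniq (L n)) ->
  (forall n x, 0 <= h n x <= K) ->
  (forall x, h n x @[n --> \oo] --> (0 : R)) ->
  (\sum_(x <- L n) g x * h n x) @[n --> \oo] --> (0 : R).
Proof.
move=> g0 [B gB] uL hK h0.
pose E := [set y : R | exists2 s : seq T, uniq s & y = \sum_(x <- s) g x].
have supE : has_sup E.
  split; first by exists 0, [::] => //; rewrite big_nil.
  by exists B => _ [s us ->]; exact: gB.
apply/cvgrPdist_le => e e0.
have K0 : 0 <= `|K| by [].
have e'0 : 0 < e / 2 / (`|K| + 1) by rewrite !divr_gt0// ltr_wpDl.
have [_ [s us ->] supEs] := sup_adherent e'0 supE.
have cs : (\sum_(x <- s) g x * h n x) @[n --> \oo] --> (0 : R).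
  rewrite -[X in _ --> X](_ : \sum_(x <- s) g x * 0 = 0); last first.
    by rewrite big1// => x _; rewrite mulr0.
  apply: cvg_big => [|x _]; first exact: add_continuous.
  by apply: cvgM; [exact: cvg_cst|exact: h0].
have e20 : 0 < e / 2 by rewrite divr_gt0.
move/cvgrPdist_le : cs => /(_ _ e20); apply: filterS => n.
have gh0 x : 0 <= g x * h n x by rewrite mulr_ge0//; have /andP[] := hK n x.
rewrite !sub0r !normrN !ger0_norm ?sumr_ge0// => se.
rewrite (bigID (mem s))/= [e]splitr lerD//.
  apply: le_trans se; rewrite -big_filter; apply: ler_sum_uniq_sub => //.
    by rewrite filter_uniq.
  by move=> x; rewrite mem_filter => /andP[].
apply: (@le_trans _ _ (\sum_(x <- L n | x \notin s) g x * `|K|)).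
  apply: ler_sum => x _; rewrite ler_wpM2l//.
  by rewrite (le_trans _ (ler_norm _))//; have /andP[] := hK n x.
rewrite -mulr_suml.
have : \sum_(x <- L n | x \notin s) g x <= e / 2 / (`|K| + 1).
  have usL : uniq (s ++ [seq x <- L n | x \notin s]).
    rewrite cat_uniq us filter_uniq// andbT/=.
    by apply/hasPn => x; rewrite mem_filter => /andP[].
  have /(sup_upper_bound supE) : E (\sum_(x <- s ++ [seq x <- L n | x \notin s]) g x).
    by exists (s ++ [seq x <- L n | x \notin s]).
  rewrite big_cat big_filter /=; move: supEs.
  by set dl := e / 2 / _; lra.
rewrite ler_pdivlMr ?ltr_wpDl// mulrDr mulr1; apply: le_trans.
by rewrite lerDl sumr_ge0.
Qed.

(** The two sums are compared over the union of their index sets, where the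
    weights differ by a bounded family tending to 0 pointwise. *)
Lemma cvg_sum_exhausting (T : eqType) (f : T -> C) (w : nat -> T -> C) (c : C)
    (K : R) (L L' : nat -> seq T) :
  bounded_sums (fun x => normc (f x)) ->
  (forall n, uniq (L n)) -> (forall n, uniq (L' n)) ->
  (forall x, \forall n \near \oo, x \in L n) ->
  (forall x, \forall n \near \oo, x \in L' n) ->
  (forall n x, normc (w n x) <= K) ->
  (forall x, w n x @[n --> \oo] --> c) ->
  (\sum_(x <- L n) f x * w n x - c * \sum_(x <- L' n) f x) @[n --> \oo] --> (0 : C).
Proof.
move=> fB uL uL' exL exL' wK wc.
pose M n := undup (L n ++ L' n).
pose v n x : C := (if x \in L n then w n x else 0) - (if x \in L' n then c else 0).
have uM n : uniq (M n) by rewrite undup_uniq.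
have diffE n : \sum_(x <- L n) f x * w n x - c * \sum_(x <- L' n) f x =
    \sum_(x <- M n) f x * v n x.
  rewrite (@big_uniq_sub _ _ _ _ (M n))//; last first.
    by move=> x xL; rewrite mem_undup mem_cat xL.
  rewrite (@big_uniq_sub _ _ _ (L' n) (M n))//; last first.
    by move=> x xL; rewrite mem_undup mem_cat xL orbT.
  rewrite mulr_sumr big_mkcond [X in _ - X]big_mkcond -sumrB; apply: eq_bigr => x _.
  by rewrite /v mulrBr; do 2!case: ifP => _; rewrite ?mulr0// [c * _]mulrC.
apply/cvg_normcP.
apply: (@squeeze_cvgr _ _ _ _ (cst 0)
    (fun n => \sum_(x <- M n) normc (f x) * normc (v n x))).
- near=> n; rewrite normc_ge0 sub0r normcN diffE (le_trans (normc_sum _ _))//.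
  by apply: ler_sum => x _; rewrite ComplexField.Normc.normcM.
- exact: cvg_cst.
apply: (@tannery_to0 _ _ _ (K + normc c)) => //.
- by move=> x; exact: normc_ge0.
- move=> n x; rewrite normc_ge0/= /v (le_trans (le_normcD _ _))// normcN lerD//.
    case: ifP => // _; rewrite ComplexField.Normc.normc0.
    by rewrite (le_trans _ (wK n x))// normc_ge0.
  by case: ifP => // _; rewrite ComplexField.Normc.normc0 normc_ge0.
- move=> x; have /cvg_normcP := wc x; apply: cvg_trans; apply: near_eq_cvg.
  near=> n; rewrite /v -normcN opprB.
  have -> : x \in L n by near: n; exact: exL.
  have -> : x \in L' n by near: n; exact: exL'.
  reflexivity.
Unshelve. all: by end_near.
Qed.

End FiniteSums.

(** * Summability of Gaussian families over the integers *)

Section Gaussian.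
Variable R : realType.
Local Notation C := (R[i] : numFieldType).

(** The triangular number n (n - 1) / 2, written with binomial coefficients so that
    it is visibly a natural number for negative n as well. *)
Definition tri (n : int) : nat :=
  match n with Posz j => 'C(j, 2) | Negz j => 'C(j.+2, 2) end.

Lemma double_bin2 n : ('C(n, 2) * 2 = n * n.-1)%N.
Proof.
elim: n => [//|n IH]; rewrite binS bin1 mulnDl IH.
by case: n {IH} => //= n; lia.
Qed.

Lemma triE n : (tri n)%:Z * 2 = n * (n - 1).
Proof.
case: n => [[|j]|j] //=; first by have := double_bin2 j.+1; rewrite /=; lia.
by have := double_bin2 j.+2; rewrite NegzE /=; lia.
Qed.

Lemma absz_mul_pred (k : int) : (absz (k * (k - 1))%R)%:Z = k * (k - 1).
Proof. by rewrite gez0_abs//; case: (lerP 1 k) => ?; nia. Qed.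

Lemma absz_sqr (k : int) : (absz (k * k)%R)%:Z = k * k.
Proof. by rewrite gez0_abs//; case: (lerP 0 k) => ?; nia. Qed.

(** The exponents tri i + tri j separate in the rotated coordinates k = (i + j) / 2
    and l = (i - j) / 2 (rounded when i + j is odd). This is what makes a product
    of two theta values a sum of two products of one-variable functions. *)
Lemma tri_rotate_even k l :
  (tri (k + l)%R + tri (k - l)%R = absz (k * (k - 1))%R + absz (l * l)%R)%N.
Proof.
apply/eqP; rewrite -eqz_nat !PoszD absz_mul_pred absz_sqr; apply/eqP.
by have := triE (k + l); have := triE (k - l); lia.
Qed.

Lemma tri_rotate_odd k l :
  (tri (k + l)%R + tri (k - l + 1)%R = absz (k * k)%R + absz (l * (l - 1))%R)%N.
Proof.
apply/eqP; rewrite -eqz_nat !PoszD absz_mul_pred absz_sqr; apply/eqP.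
by have := triE (k + l); have := triE (k - l + 1); lia.
Qed.

(** Once the ratio c n drops below 1/2, the terms are dominated by a geometric
    series. *)
Lemma bounded_sums_nat (g : nat -> R) (c : nat -> R) :
  (forall n, 0 <= g n) -> (forall n, g n.+1 <= c n * g n) ->
  c n @[n --> \oo] --> (0 : R) -> bounded_sums g.
Proof.
move=> g0 gS /cvgrPdist_lt /(_ (1 / 2)) [|m _ cm]; first by rewrite divr_gt0.
pose B := \sum_(0 <= i < m.+1) g i * 2 ^+ i.
have gB n : g n * 2 ^+ n <= B.
  have [nm|/ltnW] := leqP n m.
    rewrite /B (bigD1_seq n) ?mem_index_iota ?iota_uniq ?ltnS//=.
    by rewrite lerDl sumr_ge0// => i _; rewrite mulr_ge0// exprn_ge0.
  move=> /subnK <-; elim: (n - m)%N => [|j IH].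
    rewrite add0n /B big_nat_recr//= lerDr sumr_ge0// => i _.
    by rewrite mulr_ge0// exprn_ge0.
  rewrite addSn exprS mulrA (le_trans _ IH)// ler_wpM2r ?exprn_ge0//.
  rewrite -ler_pdivlMr// mulrC (le_trans (gS _))// ler_wpM2r//.
  have /= := cm (j + m)%N (leq_addl _ _); rewrite sub0r normrN mul1r => /ltW.
  exact/le_trans/ler_norm.
have B0 : 0 <= B by rewrite (le_trans _ (gB 0%N))// mulr_ge0.
exists (B * 2) => s us.
apply: (@le_trans _ _ (\sum_(i <- iota 0 (\max_(i <- s) i).+1) g i)).
  apply: ler_sum_uniq_sub => //; first exact: iota_uniq.
  by move=> x xs; rewrite mem_iota /= add0n ltnS; exact: leq_bigmax_seq.
move: (\max_(i <- s) i).+1 => M.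
apply: (@le_trans _ _ (\sum_(i <- iota 0 M) B * (1 / 2) ^+ i)).
  apply: ler_sum => i _; rewrite mul1r exprVn ler_pdivlMr ?exprn_gt0//.
rewrite -mulr_sumr ler_wpM2l//.
have -> : \sum_(i <- iota 0 M) (1 / 2 : R) ^+ i = 2 - 2 * (1 / 2) ^+ M.
  elim: M => [|M IH]; first by rewrite big_nil expr0 mulr1 subrr.
  by rewrite -addn1 iotaD big_cat IH /= big_seq1 add0n exprD expr1; field.
by rewrite gerBl mulr_ge0// exprn_ge0// divr_ge0.
Qed.

Lemma bounded_sums_int (g : int -> R) : (forall n, 0 <= g n) ->
  bounded_sums (fun n => g (Posz n)) -> bounded_sums (fun n => g (Negz n)) ->
  bounded_sums g.
Proof.
move=> g0 [B gB] [D gD]; exists (B + D) => s us.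
have [M sM] : exists M, forall x : int, x \in s -> (`|x| < M)%N.
  exists (\max_(i <- s) `|i|).+1 => x xs.
  by rewrite ltnS; exact: (@leq_bigmax_seq _ s xpredT absz x).
apply: (@le_trans _ _
    (\sum_(i <- [seq Posz n | n <- iota 0 M] ++ [seq Negz n | n <- iota 0 M]) g i)).
  apply: ler_sum_uniq_sub => //.
    rewrite cat_uniq !map_inj_uniq ?iota_uniq//= ?andbT; [|by move=> ? ? []..].
    by apply/hasPn => _ /mapP[n _ ->]; apply/mapP => -[].
  move=> x /sM; rewrite mem_cat; case: x => n nM; apply/orP; [left|right];
    apply/mapP; exists n => //; rewrite mem_iota add0n //=.
  exact: ltn_trans nM.
rewrite big_cat !big_map lerD//; [apply: gB|apply: gD]; exact: iota_uniq.
Qed.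

Definition gauss (p x : C) (n : int) : C := p ^+ tri n * (- x) ^ n.

Lemma normcV (z : C) : normc z^-1 = (normc z)^-1.
Proof. exact: ComplexField.Normc.normcV. Qed.

Lemma normc_gauss_bounded (p x : C) : normc p < 1 ->
  bounded_sums (fun n => normc (gauss p x n)).
Proof.
move=> p1.
have cp : (fun n => normc p ^+ n) n @[n --> \oo] --> (0 : R).
  by apply: cvg_expr; rewrite ger0_norm ?normc_ge0.
apply: bounded_sums_int => [n||]; first exact: normc_ge0.
- apply: (@bounded_sums_nat _ (fun n => normc p ^+ n * normc x)).
  + by move=> n; exact: normc_ge0.
  + move=> n; rewrite -[in leRHS]normcX -[normc x]normcN -!ComplexField.Normc.normcM.
    rewrite /gauss /= binS bin1 exprD /exprz exprSr.
    by rewrite le_eqVlt; apply/orP; left; apply/eqP; congr normc; ring.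
  + rewrite -[X in _ --> X](mul0r (normc x)); apply: cvgM => //; exact: cvg_cst.
- apply: (@bounded_sums_nat _ (fun n => normc p ^+ n * (normc p ^+ 2 * normc (- x)^-1))).
  + by move=> n; exact: normc_ge0.
  + move=> n; rewrite -!normcX -!ComplexField.Normc.normcM.
    rewrite /gauss /= ['C(n.+3, 2)]binS bin1 exprD /exprz [(- x) ^+ n.+2]exprS invfM.
    rewrite -[n.+2]addn2 exprD.
    by rewrite le_eqVlt; apply/orP; left; apply/eqP; congr normc; ring.
  + rewrite -[X in _ --> X](mul0r (normc p ^+ 2 * normc (- x)^-1)).
    apply: cvgM => //; exact: cvg_cst.
Qed.

End Gaussian.

(** * A finite form of Jacobi's triple product identity *)

Section TripleProduct.
Variable F : fieldType.
Variable p : F.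

(** (p; p)_n *)
Definition qfact (n : nat) : F := \prod_(0 <= k < n) (1 - p ^+ k.+1).

Hypothesis qfact_neq0 : forall n, qfact n != 0.

Lemma qfactS n : qfact n.+1 = qfact n * (1 - p ^+ n.+1).
Proof. by rewrite /qfact big_nat_recr. Qed.

Definition qbinom (n i : nat) : F := qfact n / (qfact i * qfact (n - i)).

(** Pascal's rule for Gaussian binomials, in the form that matches the extra factor
    1 - z p^n of the product. *)
Lemma qbinom_pascal n i : (i < n)%N ->
  qbinom n.+1 i.+1 = qbinom n i.+1 + p ^+ (n - i) * qbinom n i.
Proof.
move=> i_n; rewrite /qbinom subSS.
have -> : (n - i = (n - i.+1).+1)%N by lia.
set m := (n - i.+1)%N; rewrite !qfactS.
have -> : n.+1 = (i.+1 + m.+1)%N by lia.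
rewrite exprD.
have := qfact_neq0 i.+1; have := qfact_neq0 m.+1; rewrite !qfactS !mulf_eq0.
rewrite !negb_or => /andP[m0 pm0] /andP[i0 pi0].
by field; rewrite m0 pm0 i0 pi0.
Qed.

Lemma qbinomn0 n : qbinom n 0 = 1.
Proof.
by rewrite /qbinom subn0 {2}/qfact big_nil mul1r divff.
Qed.

Lemma qbinomnn n : qbinom n n = 1.
Proof.
by rewrite /qbinom subnn {3}/qfact big_nil mulr1 divff.
Qed.

Lemma qbinomial_theorem n z : \prod_(0 <= k < n) (1 - z * p ^+ k) =
  \sum_(0 <= i < n.+1) qbinom n i * p ^+ 'C(i, 2) * (- z) ^+ i.
Proof.
elim: n => [|n IH]; first by rewrite big_nil big_nat1 qbinomn0 !mulr1.
rewrite big_nat_recr//= IH mulrBr mulr1.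
rewrite [RHS]big_nat_recl// [in RHS]big_nat_recr//=.
rewrite [X in X - _]big_nat_recl// [X in _ - X * _]big_nat_recr//=.
rewrite !qbinomn0 !qbinomnn -!addrA; congr (_ + _).
rewrite mulrDl mulr_suml opprD addrA -sumrB; congr (_ + _).
  rewrite !big_nat; apply: eq_bigr => i /andP[_ i_n].
  rewrite qbinom_pascal// binS bin1 exprD exprS -[in p ^+ n](subnK (ltnW i_n)) exprD.
  by ring.
by rewrite binS bin1 exprD exprS; ring.
Qed.

Definition int_range (N : nat) : seq int := [seq i%:Z - N%:Z | i <- iota 0 (2 * N).+1].

Lemma mem_int_range N (n : int) : (n \in int_range N) = (`|n| <= N)%N.
Proof.
apply/mapP/idP => [[j]|nN]; first by rewrite mem_iota => jN ->; lia.
exists (absz (n + N%:Z)%R); [rewrite mem_iota|]; lia.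
Qed.

Lemma int_range_uniq N : uniq (int_range N).
Proof. by rewrite map_inj_uniq ?iota_uniq// => i j; lia. Qed.

(** The Gaussian binomial (2N choose N + n), extended to all integers n by absolute
    values so that it is bounded uniformly in N and n. *)
Definition jtp_coef (N : nat) (n : int) : F :=
  qfact (2 * N) / (qfact (absz (N%:Z + n)%R) * qfact (absz (N%:Z - n)%R)).

(** The q-binomial theorem for 2N factors, evaluated at x / p^N: the lower half of
    the factors turns into the product of the 1 - p^(k+1) / x up to a monomial,
    which shifts the exponents 'C(i, 2) to tri (i - N). *)
Lemma finite_triple_product N x : p != 0 -> x != 0 ->
  \prod_(0 <= k < N) (1 - x * p ^+ k) * \prod_(0 <= k < N) (1 - p / x * p ^+ k) =
  \sum_(n <- int_range N) p ^+ tri n * (- x) ^ n * jtp_coef N n.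
Proof.
move=> p0 x0.
have Nx0 : - x != 0 by rewrite oppr_eq0.
have low : \prod_(0 <= k < N) (1 - x / p ^+ N * p ^+ k) =
    (- x) ^+ N / p ^+ 'C(N.+1, 2) * \prod_(0 <= k < N) (1 - p / x * p ^+ k).
  have -> : (- x) ^+ N / p ^+ 'C(N.+1, 2) = \prod_(0 <= k < N) (- x / p ^+ k.+1).
    elim: N => [|N IH]; first by rewrite big_nil divr1.
    rewrite big_nat_recr//= -IH binS bin1 exprD exprSr; field.
    by rewrite !expf_neq0.
  rewrite -big_split big_nat_rev /= !big_nat; apply: eq_bigr => k /andP[_ kN].
  rewrite add0n exprS -[in p ^+ N](subnK kN) addnC exprD exprS; field.
  by rewrite x0 p0 !expf_neq0.
have := qbinomial_theorem (2 * N) (x / p ^+ N).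
rewrite mul2n -addnn (big_cat_nat (n := N)) ?leq_addr//= low.
have -> : \prod_(N <= k < N + N) (1 - x / p ^+ N * p ^+ k) =
    \prod_(0 <= k < N) (1 - x * p ^+ k).
  rewrite -{1}[N]add0n big_addn addnK; apply: eq_bigr => k _.
  by rewrite addnC exprD mulrA divfK ?expf_neq0.
set A := \prod_(0 <= k < N) _; set B := \prod_(0 <= k < N) _ => AB.
have -> : B * A = p ^+ 'C(N.+1, 2) / (- x) ^+ N *
    ((- x) ^+ N / p ^+ 'C(N.+1, 2) * A * B).
  by field; rewrite !expf_neq0.
rewrite AB mulr_sumr /int_range mul2n -addnn big_map /index_iota subn0.
rewrite !big_seq; apply: eq_bigr => i; rewrite mem_iota => iN.
rewrite /jtp_coef /qbinom.
have -> : absz (N%:Z + (i%:Z - N%:Z))%R = i by lia.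
have -> : absz (N%:Z - (i%:Z - N%:Z))%R = (N + N - i)%N by lia.
rewrite mul2n -addnn expfzDr// exprnN.
rewrite -mulNr exprMn exprVn -exprM.
have tE : ('C(N.+1, 2) + 'C(i, 2) = tri (i%:Z - N%:Z) + N * i)%N.
  have := triE (i%:Z - N%:Z); have := double_bin2 N.+1; have := double_bin2 i.
  by case: i {iN} => [|i] /=; nia.
have {}tE : p ^+ 'C(i, 2) = p ^+ tri (i%:Z - N%:Z) * p ^+ (N * i) / p ^+ 'C(N.+1, 2).
  by rewrite -exprD -tE exprD mulrC mulKf ?expf_neq0.
rewrite tE /exprz; field.
by rewrite !qfact_neq0 !expf_neq0.
Qed.

Lemma rotate_exprz (s t : F) (k l : int) : s != 0 -> t != 0 ->
  (- s) ^ (k + l) * (- t) ^ (k - l) = (s * t) ^ k * (s / t) ^ l.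
Proof.
move=> s0 t0; have [Ns0 Nt0] : - s != 0 /\ - t != 0 by rewrite !oppr_eq0.
rewrite !expfzDr// mulrACA -exprz_inv -!exprzMl ?unitfE ?invr_eq0//.
by rewrite mulrNN invrN mulrNN.
Qed.

End TripleProduct.
Arguments int_range N : simpl never.

(** * The addition formula for theta functions *)

(** Weierstrass' addition formula
    theta(xy, x/y, zv, z/v) - theta(xv, x/v, zy, z/y)
      = (z/y) theta(yv, y/v, xz, x/z),
    rewritten so that the arguments are monomials in four independent variables
    and no square root has to be chosen. *)
Definition three_term_relation (F : fieldType) (th : F -> F) :=
  forall e f s t : F, e != 0 -> f != 0 -> s != 0 -> t != 0 ->
  th (e * f) * th (f * s * t / e) * (th s * th t) =
  th e * th (s * t / e) * (th (f * s) * th (f * t)) +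
  e * (th f * th (f * s * t) * (th (s / e) * th (t / e))).

Section Weierstrass.
Variable R : realType.
Local Notation C := (R[i] : numFieldType).
Variable p : C.
Hypothesis p_lt1 : `|p| < 1.

Let r_lt1 : normc p < 1.
Proof. by move: p_lt1; rewrite normC_normc -[1]/((1 : R)%:C) ltcR. Qed.

Let r01 : 0 <= normc p < 1. Proof. by rewrite normc_ge0 r_lt1. Qed.

Lemma qpoch_inf_cvg x :
  (\prod_(0 <= k < N) (1 - x * p ^+ k)) @[N --> \oo] --> qpoch_inf p x.
Proof.
apply: (@cvgn_prod1D _ (fun k => - (x * p ^+ k)) (normc x) (normc p)) => // n.
by rewrite normcN ComplexField.Normc.normcM normcX.
Qed.

Lemma theta_cvg x :
  (\prod_(0 <= k < N) (1 - x * p ^+ k) * \prod_(0 <= k < N) (1 - p / x * p ^+ k))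
    @[N --> \oo] --> theta p x.
Proof. by apply: cvgM; exact: qpoch_inf_cvg. Qed.

Lemma one_sub_expr_neq0 k : 1 - p ^+ k.+1 != 0.
Proof.
rewrite subr_eq0; apply/eqP => /(congr1 (@normc _)).
rewrite ComplexField.Normc.normc1 normcX => /eqP.
by rewrite eq_sym lt_eqF// exprn_ilt1 ?normc_ge0.
Qed.

Lemma qfact_neq0 n : qfact p n != 0.
Proof.
by rewrite prodf_seq_neq0; apply/allP => k _; exact: one_sub_expr_neq0.
Qed.

Lemma qfact_cvg : qfact p n @[n --> \oo] --> qpoch_inf p p.
Proof.
rewrite (_ : qfact p = fun n => \prod_(0 <= k < n) (1 - p * p ^+ k)).
  exact: qpoch_inf_cvg.
by apply/funext => n; apply: eq_bigr => k _; rewrite exprS.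
Qed.

(** The inverse product is itself of the form prod (1 + a_k) with a_k decaying
    geometrically, hence also has a limit, so neither limit vanishes. *)
Lemma qfactV_cvg : cvgn (fun n => (qfact p n)^-1).
Proof.
rewrite (_ : (fun n => _) = fun n =>
    \prod_(0 <= k < n) (1 + p ^+ k.+1 / (1 - p ^+ k.+1))); last first.
  apply/funext => n; rewrite -prodfV; apply: eq_bigr => k _.
  by field; exact: one_sub_expr_neq0.
apply: (@cvgn_prod1D _ _ (normc p / (1 - normc p)) (normc p)) => // n.
rewrite ComplexField.Normc.normcM normcV normcX exprS mulrAC.
rewrite ler_wpM2r ?exprn_ge0 ?normc_ge0// ler_wpM2l ?normc_ge0//.
rewrite lef_pV2 ?posrE ?subr_gt0//; last first.
  rewrite lt_neqAle normc_ge0 andbT eq_sym; apply/eqP => /ComplexField.Normc.eq0_normc/eqP.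
  exact/negP/one_sub_expr_neq0.
have : normc (1 : C) <= normc (1 - p ^+ n.+1) + normc (p ^+ n.+1).
  by apply: le_trans (le_normcD _ _); rewrite subrK.
rewrite ComplexField.Normc.normc1 normcX.
have : normc p ^+ n.+1 <= normc p.
  by rewrite exprS ler_piMr ?normc_ge0// exprn_ile1 ?normc_ge0// ltW.
by lra.
Qed.

Lemma qpoch_inf_p_neq0 : qpoch_inf p p != 0.
Proof.
have /cvg_ex[l lP] := qfactV_cvg.
have H : (1 : C) = qpoch_inf p p * l.
  apply: (@cvgc_unique _ (fun n => qfact p n * (qfact p n)^-1)).
  - rewrite (_ : (fun n => _) = cst 1); first exact: cvg_cst.
    by apply/funext => n; rewrite mulfV// qfact_neq0.
  - by apply: cvgM; [exact: qfact_cvg|exact: lP].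
by apply/eqP => P0; move/eqP: H; rewrite P0 mul0r oner_eq0.
Qed.

Lemma cvgn_normc_bounded (u : nat -> C) : cvgn u -> exists B, forall n, normc (u n) <= B.
Proof.
move=> /cvg_seq_bounded[M [Mreal]] /(_ (M + 1)) MB.
exists (complex.Re (M + 1)) => n.
have M1 : M + 1 \is Num.real by rewrite realD// real1.
by rewrite -lecR -normC_normc RRe_real//; apply: MB => //; rewrite ltrDl.
Qed.

Lemma jtp_coef_bounded : exists B, forall N n, normc (jtp_coef p N n) <= B.
Proof.
have [A qA] := cvgn_normc_bounded (cvgP _ qfact_cvg).
have [B qB] := cvgn_normc_bounded qfactV_cvg.
exists (A * (B * B)) => N n.
rewrite /jtp_coef invfM !ComplexField.Normc.normcM.
by rewrite ler_pM ?mulr_ge0 ?normc_ge0// ler_pM ?normc_ge0.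
Qed.

Lemma cvgn_absz_shift (f : nat -> C) (l : C) (n : int) : f N @[N --> \oo] --> l ->
  f (absz (N%:Z + n)%R) @[N --> \oo] --> l.
Proof.
move=> fl; apply: (cvg_comp _ _ _ fl) => A [M _ MA].
by exists (M + absz n)%N => // N /= MN; apply: MA => /=; lia.
Qed.

Lemma jtp_coef_cvg n : jtp_coef p N n @[N --> \oo] --> (qpoch_inf p p)^-1.
Proof.
have P0 := qpoch_inf_p_neq0.
rewrite -[X in _ --> X](_ : qpoch_inf p p / (qpoch_inf p p * qpoch_inf p p) = _); last by field.
apply: cvgM.
  apply: (cvg_comp _ _ _ qfact_cvg) => A [M _ MA].
  by exists M => // N /= MN; apply: MA => /=; lia.
apply: cvgV; first by rewrite mulf_neq0.
by apply: cvgM; apply: cvgn_absz_shift; exact: qfact_cvg.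
Qed.

(** The integers of ]-N, N], symmetric about 1/2: on this range the sum of
    p^(k (k - 1)) z^k satisfies its reflection formula exactly at every finite
    stage. *)
Definition half_range (N : nat) : seq int := [seq i%:Z - N%:Z + 1 | i <- iota 0 (2 * N)].

Lemma mem_half_range N (n : int) : (n \in half_range N) = (- N%:Z < n <= N%:Z).
Proof.
apply/mapP/idP => [[j]|nN]; first by rewrite mem_iota => jN ->; lia.
by exists (absz (n + N%:Z - 1)%R); [rewrite mem_iota|]; lia.
Qed.

Lemma half_range_uniq N : uniq (half_range N).
Proof. by rewrite map_inj_uniq ?iota_uniq// => i j; lia. Qed.

Arguments half_range N : simpl never.

Definition square_sum N (z : C) : C :=
  \sum_(k <- int_range N) p ^+ absz (k * k)%R * z ^ k.
Definition pronic_sum N (z : C) : C :=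
  \sum_(k <- half_range N) p ^+ absz (k * (k - 1))%R * z ^ k.

Lemma square_sumV N z : square_sum N z^-1 = square_sum N z.
Proof.
rewrite /square_sum (perm_big [seq - k | k <- int_range N]).
  rewrite big_map; apply: eq_bigr => k _; rewrite mulrNN.
  by rewrite exprz_inv opprK.
apply: uniq_perm; [exact: int_range_uniq|by rewrite (map_inj_uniq oppr_inj) int_range_uniq|].
move=> k; rewrite -[k in RHS]opprK (mem_map oppr_inj) !mem_int_range.
by rewrite abszN.
Qed.

Lemma pronic_sumV N z : z != 0 -> pronic_sum N z^-1 = pronic_sum N z / z.
Proof.
move=> z0; rewrite /pronic_sum (perm_big [seq 1 - k | k <- half_range N]).
  rewrite big_map mulr_suml; apply: eq_bigr => k _.
  rewrite exprz_inv -mulrA opprB expfzDr//; congr (p ^+ absz _ * _); ring.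
have subI : injective (fun k : int => 1 - k) by move=> i j; lia.
apply: uniq_perm; [exact: half_range_uniq|by rewrite (map_inj_uniq subI) half_range_uniq|].
move=> k; have -> : k = 1 - (1 - k) by ring.
rewrite (mem_map subI).
by rewrite !mem_half_range; lia.
Qed.

(** A 2x2 minor built from the two truncated series. Up to a constant it
    converges to theta(s) theta(t). *)
Definition theta_pair N (s t : C) : C :=
  pronic_sum N (s * t) * square_sum N (s / t)
  - t * square_sum N (s * t) * pronic_sum N (s / t).

(** Up to a factor each pair is a 2x2 minor of the 2x4 matrix with columns
    (pronic_sum z, sqrt z * square_sum z) at the four points f^2 s t, e^2 / (s t),
    s t and s / t, and this is the Pluecker relation between these minors. The
    reflection formulas account for the inverses of these points. *)
Lemma theta_pair_identity N e f s t : e != 0 -> f != 0 -> s != 0 -> t != 0 ->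
  theta_pair N (e * f) (f * s * t / e) * theta_pair N s t =
  theta_pair N e (s * t / e) * theta_pair N (f * s) (f * t) +
  e * (theta_pair N f (f * s * t) * theta_pair N (s / e) (t / e)).
Proof.
move=> e0 f0 s0 t0; rewrite /theta_pair.
have -> : e * f * (f * s * t / e) = f * f * s * t by field.
have -> : e * f / (f * s * t / e) = e * e / (s * t) by field; rewrite e0 f0 s0 t0.
have -> : e * (s * t / e) = s * t by field.
have -> : e / (s * t / e) = e * e / (s * t) by field; rewrite e0 s0 t0.
have -> : f * s * (f * t) = f * f * s * t by ring.
have -> : f * s / (f * t) = s / t by field; rewrite f0 t0.
have -> : f * (f * s * t) = f * f * s * t by ring.
have -> : f / (f * s * t) = (s * t)^-1 by field; rewrite f0 s0 t0.
have -> : s / e * (t / e) = (e * e / (s * t))^-1 by field; rewrite e0 s0 t0.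
have -> : s / e / (t / e) = s / t by field; rewrite e0 t0.
rewrite !square_sumV !pronic_sumV ?mulf_neq0 ?invr_eq0 ?mulf_neq0//.
move: (pronic_sum N (f * f * s * t)) (square_sum N (f * f * s * t)) => a1 b1.
move: (pronic_sum N (e * e / (s * t))) (square_sum N (e * e / (s * t))) => a2 b2.
move: (pronic_sum N (s * t)) (square_sum N (s * t)) => a3 b3.
move: (pronic_sum N (s / t)) (square_sum N (s / t)) => a4 b4.
by field; rewrite e0 s0 t0.
Qed.

Definition box (N : nat) : seq (int * int) :=
  [seq (i, j) | i <- int_range N, j <- int_range N].

Lemma box_uniq N : uniq (box N).
Proof. by apply: allpairs_uniq; [exact: int_range_uniq..|move=> [? ?] []]. Qed.

Lemma mem_box (i j : int) N : (absz i + absz j <= N)%N -> (i, j) \in box N.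
Proof.
by move=> ijN; apply/allpairsP; exists (i, j); rewrite !mem_int_range /=; split => //; lia.
Qed.

(** The index set of the double sum obtained by expanding theta_pair: pairs (i, j)
    with even sum come from its first product, those with odd sum from the second. *)
Definition rotated_box (N : nat) : seq (int * int) :=
  [seq (k + l, k - l) | k <- half_range N, l <- int_range N] ++
  [seq (k + l, k - l + 1) | k <- int_range N, l <- half_range N].

Lemma rotated_box_uniq N : uniq (rotated_box N).
Proof.
rewrite cat_uniq; apply/and3P; split.
- apply: allpairs_uniq; [exact: half_range_uniq|exact: int_range_uniq|].
  by move=> [k l] [k' l'] _ _ /= [? ?]; congr (_, _); lia.
- apply/hasPn => x /allpairsP[[k l] [_ _ ->]].
  by apply/negP => /allpairsP[[k' l'] [_ _ /= [? ?]]]; lia.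
- apply: allpairs_uniq; [exact: int_range_uniq|exact: half_range_uniq|].
  by move=> [k l] [k' l'] _ _ /= [? ?]; congr (_, _); lia.
Qed.

Lemma mem_rotated_box (i j : int) N : (absz i + absz j < N)%N -> (i, j) \in rotated_box N.
Proof.
move=> ijN; rewrite mem_cat.
have [k [ijk|ijk]] : exists k : int, i + j = k + k \/ i + j = k + k + 1.
  by exists ((i + j) %/ 2)%Z; lia.
- apply/orP; left; apply/allpairsP; exists (k, i - k).
  by rewrite mem_half_range mem_int_range /=; split; [lia|lia|congr (_, _); lia].
- apply/orP; right; apply/allpairsP; exists (k, i - k).
  by rewrite mem_half_range mem_int_range /=; split; [lia|lia|congr (_, _); lia].
Qed.

Lemma sum_rotated_box N s t : s != 0 -> t != 0 ->
  \sum_(x <- rotated_box N) gauss p s x.1 * gauss p t x.2 = theta_pair N s t.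
Proof.
move=> s0 t0; have [Ns0 Nt0] : - s != 0 /\ - t != 0 by rewrite !oppr_eq0.
have NstE k l := rotate_exprz k l s0 t0.
rewrite big_cat !big_allpairs_dep /theta_pair /pronic_sum /square_sum /=.
congr (_ + _).
  rewrite mulr_suml; apply: eq_bigr => k _.
  rewrite mulr_sumr; apply: eq_bigr => l _; rewrite /gauss mulrACA NstE [RHS]mulrACA.
  congr (_ * _); rewrite -!exprD; congr (p ^+ _).
  exact: tri_rotate_even.
rewrite -mulrA mulr_suml mulr_sumr -sumrN; apply: eq_bigr => k _.
rewrite !mulr_sumr -sumrN; apply: eq_bigr => l _.
rewrite /gauss mulrACA [(- t) ^ (k - l + 1)]expfzDr// [X in _ * X]mulrA NstE -exprD.
rewrite tri_rotate_odd.
by rewrite exprD expr1z; ring.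
Qed.

(** The finite triple products expand theta(s) theta(t) over a square box of
    exponents, theta_pair expands over the rotated box; both boxes exhaust the
    plane, so by dominated convergence the difference vanishes in the limit. *)
Lemma theta_mul_cvg s t : p != 0 -> s != 0 -> t != 0 ->
  (qpoch_inf p p ^- 2 * theta_pair N s t : C) @[N --> \oo] --> theta p s * theta p t.
Proof.
move=> p0 s0 t0.
pose T N x : C := \prod_(0 <= k < N) (1 - x * p ^+ k) *
  \prod_(0 <= k < N) (1 - p / x * p ^+ k).
have TE N : T N s * T N t = \sum_(x <- box N)
    gauss p s x.1 * gauss p t x.2 * (jtp_coef p N x.1 * jtp_coef p N x.2).
  rewrite /T !finite_triple_product//; [|exact: qfact_neq0..].
  rewrite big_allpairs mulr_suml; apply: eq_bigr => i _.
  by rewrite mulr_sumr; apply: eq_bigr => j _; rewrite mulrACA.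
have [B cB] := jtp_coef_bounded.
have := @cvg_sum_exhausting R _ (fun x : int * int => gauss p s x.1 * gauss p t x.2)
  (fun N x => jtp_coef p N x.1 * jtp_coef p N x.2) (qpoch_inf p p ^- 2) (B * B)
  box rotated_box.
move=> H.
have {}H : (T N s * T N t - qpoch_inf p p ^- 2 * theta_pair N s t) @[N --> \oo] --> (0 : C).
  under eq_fun do rewrite TE -sum_rotated_box//.
  apply: H => [|N|N|[i j]|[i j]|N x|x].
  - rewrite (_ : (fun x => _) = fun x : int * int => normc (gauss p s x.1) * normc (gauss p t x.2)).
      apply: (bounded_sums_mul (g := fun i => normc (gauss p s i))
        (h := fun j => normc (gauss p t j))); by [move=> ?; exact: normc_ge0|
        exact: normc_gauss_bounded].
    by apply/funext => x; rewrite ComplexField.Normc.normcM.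
  - exact: box_uniq.
  - exact: rotated_box_uniq.
  - by exists (absz i + absz j)%N => // N ijN; exact: mem_box.
  - by exists (absz i + absz j).+1 => // N ijN; exact: mem_rotated_box.
  - by rewrite ComplexField.Normc.normcM ler_pM ?normc_ge0.
  - rewrite -exprVn expr2; apply: cvgM; exact: jtp_coef_cvg.
rewrite (_ : (fun N => _) = fun N => T N s * T N t -
    (T N s * T N t - qpoch_inf p p ^- 2 * theta_pair N s t)); last first.
  by apply/funext => N; rewrite opprB addrC subrK.
rewrite -[X in _ --> X]subr0; apply: cvgB; last exact: H.
by apply: cvgM; exact: theta_cvg.
Qed.

(** The Pluecker relation holds at every finite stage, hence for the limits. *)
Lemma weierstrass_neq0 e f s t : p != 0 -> e != 0 -> f != 0 -> s != 0 -> t != 0 ->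
  theta p (e * f) * theta p (f * s * t / e) * (theta p s * theta p t) =
  theta p e * theta p (s * t / e) * (theta p (f * s) * theta p (f * t)) +
  e * (theta p f * theta p (f * s * t) * (theta p (s / e) * theta p (t / e))).
Proof.
move=> p0 e0 f0 s0 t0.
set c := qpoch_inf p p ^- 2.
apply: (@cvgc_unique _ (fun N => c * theta_pair N (e * f) (f * s * t / e) *
  (c * theta_pair N s t))).
  by apply: cvgM; apply: theta_mul_cvg; rewrite ?mulf_neq0 ?invr_eq0.
rewrite (_ : (fun N => _) = fun N =>
  c * theta_pair N e (s * t / e) * (c * theta_pair N (f * s) (f * t)) +
  e * (c * theta_pair N f (f * s * t) * (c * theta_pair N (s / e) (t / e)))); last first.
  apply/funext => N; have := theta_pair_identity N e0 f0 s0 t0.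
  move: (theta_pair N _ _) (theta_pair N s t) (theta_pair N e _) (theta_pair N _ _)
    (theta_pair N f _) (theta_pair N _ _) c => x1 x2 x3 x4 x5 x6 c x12.
  by rewrite mulrACA x12; ring.
by apply: cvgD; [|apply: cvgM; first exact: cvg_cst]; apply: cvgM;
  apply: theta_mul_cvg; rewrite ?mulf_neq0 ?invr_eq0.
Qed.

(** For p = 0 the triple product degenerates, but so does theta. *)
Lemma theta_p0 x : p = 0 -> theta p x = 1 - x.
Proof.
move=> p0.
have lim1 (y : C) : qpoch_inf p y = 1 - y.
  apply: (cvgc_eventually_cst (@qpoch_inf_cvg y)) => N.
  rewrite big_nat_recl// expr0 mulr1.
  by rewrite big1 ?mulr1// => k _; rewrite p0 exprS mul0r mulr0 subr0.
by rewrite /theta !lim1 p0 mul0r subr0 mulr1.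
Qed.

Lemma theta_weierstrass : three_term_relation (theta p).
Proof.
move=> e f s t e0 f0 s0 t0; have [p0|p0] := eqVneq p 0; last exact: weierstrass_neq0.
by rewrite !theta_p0//; field.
Qed.

Lemma theta1 : theta p 1 = 0.
Proof.
rewrite /theta (_ : qpoch_inf p 1 = 0) ?mul0r//.
apply: (cvgc_eventually_cst (@qpoch_inf_cvg 1)) => N.
by rewrite big_nat_recl// expr0 mulr1 subrr mul0r.
Qed.

End Weierstrass.

(** * Enumeration of lattice paths *)

Section Paths.
Variable C : numFieldType.
Variables a b q p : C.
Variables l k : int.

Fixpoint path_list (d : nat) (v : int * int) : seq (seq (int * int)) :=
  if d is d'.+1 then
    [seq rcons P v | P <- path_list d' (v.1 - 1, v.2)] ++
    [seq rcons P v | P <- path_list d' (v.1, v.2 - 1)]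
  else if v == (l, k) then [:: [:: v]] else [::].

(** A boolean membership test for lattice_paths (l, k) v. *)
Definition is_lattice_path (v : int * int) (P : seq (int * int)) : bool :=
  if P is x :: s then
    [&& x == (l, k), path (fun y z => hstep y z || vstep y z) x s & last x s == v]
  else false.

Lemma is_lattice_path_rcons v w P : P != [::] ->
  is_lattice_path v (rcons P w) =
  [&& w == v, is_lattice_path (last (l, k) P) P &
      hstep (last (l, k) P) w || vstep (last (l, k) P) w].
Proof.
case: P => // x s _ /=; rewrite rcons_path last_rcons eqxx andbT.
by rewrite andbC -!andbA; do !bool_congr.
Qed.

Lemma hstepE u v : hstep u v = (u == (v.1 - 1, v.2)).
Proof.
case: u v => [x y] [x' y']; rewrite /hstep xpair_eqE /=.
by apply/andP/andP => -[/eqP-> /eqP->]; split; apply/eqP; lia.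
Qed.

Lemma vstepE u v : vstep u v = (u == (v.1, v.2 - 1)).
Proof.
case: u v => [x y] [x' y']; rewrite /vstep xpair_eqE /=.
by apply/andP/andP => -[/eqP-> /eqP->]; split; apply/eqP; lia.
Qed.

Lemma hstep_vstepF u v : hstep u v -> vstep u v = false.
Proof.
by rewrite hstepE vstepE => /eqP->; rewrite xpair_eqE; apply/negP => /andP[/eqP]; lia.
Qed.

Lemma mem_path_list d v P :
  (P \in path_list d v) = (size P == d.+1) && is_lattice_path v P.
Proof.
elim: d v P => [|d IH] v P /=.
  case: P => [|x [|y s]] /=.
  - by case: ifP.
  - have [->|vlk] := eqVneq v (l, k).
      by rewrite mem_seq1 eqseq_cons andbT andbb.
    by case: eqVneq => [->|//]; rewrite eq_sym (negPf vlk).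
  - by case: ifP => // _; rewrite mem_seq1 eqseq_cons andbF.
case/lastP: P => [|P w].
  by rewrite mem_cat; apply/negP => /orP[] /mapP[P _ /esym/eqP];
    rewrite -size_eq0 size_rcons.
have mem_rcons (s : seq (seq (int * int))) :
    (rcons P w \in [seq rcons Q v | Q <- s]) = (w == v) && (P \in s).
  apply/mapP/andP => [[Q Qs /rcons_inj[-> ->]] //|[/eqP-> Ps]].
  by exists P.
rewrite mem_cat !{}mem_rcons -andb_orr !IH size_rcons eqSS.
have [->|P0] := eqVneq P [::].
  by rewrite /= !andbF.
rewrite is_lattice_path_rcons// hstepE vstepE.
case: (eqVneq w v) => [->|_] /=; last by rewrite andbF.
rewrite -andb_orr; congr (_ && _).
have [Plast|] := boolP (is_lattice_path (last (l, k) P) P).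
  by case: P P0 Plast => // x s _ /= /and3P[-> -> _].
case: P P0 => // x s _ /=; rewrite eqxx andbT => /negPf.
by rewrite !andbA => ->.
Qed.

Lemma path_list_uniq d v : uniq (path_list d v).
Proof.
elim: d v => [|d IH] v /=; first by case: ifP.
have inj : injective (fun P : seq (int * int) => rcons P v).
  by move=> P Q /rcons_inj[].
rewrite cat_uniq !map_inj_uniq ?IH//= andbT.
apply/hasPn => _ /mapP[P Pv ->]; apply/mapP => -[Q Qv /inj PQ]; move: Pv Qv.
rewrite -{}PQ !mem_path_list => /andP[_ P1] /andP[_ P2].
case: P P1 P2 => // x s /= /and3P[_ _ /eqP->] /and3P[_ _].
by rewrite xpair_eqE => /andP[/eqP]; lia.
Qed.

Lemma is_lattice_path_size v P : is_lattice_path v P ->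
  (size P)%:Z = v.1 - l + (v.2 - k) + 1.
Proof.
elim/last_ind: P v => // P w IH v.
have [->|P0] := eqVneq P [::].
  by rewrite /= => /andP[/eqP-> /eqP<-] /=; lia.
rewrite is_lattice_path_rcons// size_rcons => /and3P[/eqP-> /IH].
by rewrite hstepE vstepE => H /orP[] /eqP e; move: H; rewrite e /=; lia.
Qed.

Lemma lattice_paths_path_list d (v : int * int) : v.1 - l + (v.2 - k) = d%:Z ->
  lattice_paths (l, k) v = [set` path_list d v].
Proof.
move=> vd; apply/seteqP; split => P /=; rewrite mem_path_list.
  case: P => // x s Pv; have {}Pv : is_lattice_path v (x :: s) := Pv.
  rewrite Pv andbT; have /eqP := is_lattice_path_size Pv.
  by rewrite vd addrC -intS eqz_nat.
by case: P => // x s /andP[].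
Qed.

Lemma path_weight_rcons P v : P != [::] ->
  path_weight a b q p (rcons P v) = path_weight a b q p P *
    (if hstep (last (l, k) P) v then weight a b q p v.1 v.2 else 1).
Proof.
rewrite /path_weight; case: P => // x s _; rewrite last_cons /behead rcons_cons.
elim: s x => [|y s IH] x.
  by rewrite /= big_cons !big_nil mul1r mulr1.
by rewrite /= !big_cons /= IH /=; case: ifP => //; rewrite mulrA.
Qed.

Definition list_weight d v := \sum_(P <- path_list d v) path_weight a b q p P.

(** A nonempty path ends with a horizontal or with a vertical step into v. *)
Lemma list_weightS d v : list_weight d.+1 v =
  list_weight d (v.1 - 1, v.2) * weight a b q p v.1 v.2 + list_weight d (v.1, v.2 - 1).
Proof.
rewrite /list_weight /= big_cat !big_map /= mulr_suml; congr (_ + _).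
  rewrite !big_seq; apply: eq_bigr => P; rewrite mem_path_list => /andP[sP latP].
  have P0 : P != [::] by case: P sP latP.
  rewrite path_weight_rcons// hstepE.
  by case: P latP {P0 sP} => // x s /and3P[_ _ /= ->].
rewrite !big_seq; apply: eq_bigr => P; rewrite mem_path_list => /andP[sP latP].
have P0 : P != [::] by case: P sP latP.
rewrite path_weight_rcons//.
case: P latP {P0 sP} => // x s /and3P[_ _ /eqP /= ->].
rewrite ifF ?mulr1//; apply/negP => /hstep_vstepF.
by rewrite vstepE eqxx.
Qed.

Lemma list_weight_out d (v : int * int) : v.1 < l \/ v.2 < k -> list_weight d v = 0.
Proof.
elim: d v => [|d IH] v v_out.
  rewrite /list_weight /=; case: eqVneq => [e|_]; last by rewrite big_nil.
  by move: v_out; rewrite e /=; lia.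
by rewrite list_weightS !IH ?mul0r ?addr0//=; lia.
Qed.

Lemma paths_weightE d (v : int * int) : v.1 - l + (v.2 - k) = d%:Z ->
  paths_weight a b q p (lattice_paths (l, k) v) = list_weight d v.
Proof.
move=> vd; rewrite /paths_weight (lattice_paths_path_list vd).
by rewrite -fsbig_seq// path_list_uniq.
Qed.

End Paths.

(** * The recurrence of the closed form *)

Section ClosedForm.
Variable F : fieldType.
Variable th : F -> F.
Variables q c h g u v w kp : F.
Hypotheses (q_neq0 : q != 0) (v_neq0 : v != 0) (w_neq0 : w != 0).
Hypothesis vw : v * w = u * q.
Hypothesis weierstrass : three_term_relation th.

Definition poch x n : F := \prod_(0 <= i < n) th (x * q ^+ i).

Lemma poch0 x : poch x 0 = 1. Proof. by rewrite /poch big_nil. Qed.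

Lemma pochSr x n : poch x n.+1 = poch x n * th (x * q ^+ n).
Proof. by rewrite /poch big_nat_recr. Qed.

Lemma pochSl x n : poch x n.+1 = th x * poch (x * q) n.
Proof.
rewrite /poch big_nat_recl// expr0 mulr1; congr (_ * _).
by apply: eq_bigr => i _; rewrite exprS mulrA.
Qed.

Lemma poch_neq0P x n :
  reflect (forall i, (i < n)%N -> th (x * q ^+ i) != 0) (poch x n != 0).
Proof.
rewrite /poch prodf_seq_neq0; apply: (iffP allP) => H i.
  by move=> i_n; apply: H; rewrite mem_index_iota.
by rewrite mem_index_iota => /H.
Qed.

(** The weight of the edge into the point (l + N + 1, k + M), where
    c = a q^(1 + l), h = b q^(1 + 2 l), g = a q^(1 - l) / b, kp = q^k, and
    u = c kp^2, v = h kp, w = g kp. *)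
Definition step_weight N M : F :=
  th (u * q ^+ (N + 2 * M)) * th (h * q ^+ (2 * N).+1) * th (h * q ^+ (2 * N)) *
  th (g / q ^+ N.+1) * th (g / q ^+ N.+2) /
  (th (c * q ^+ N) * th (v * q ^+ (2 * N + M).+1) * th (v * q ^+ (2 * N + M)) *
   th (w * q ^+ M / q ^+ N.+1) * th (w * q ^+ M / q ^+ N.+2)) * (kp * q ^+ M).

(** The closed form for the target (l + N, k + M) splits into the factors of length
    M = m - k and those that depend on N = n - l only. *)
Definition height_part N M : F :=
  poch (q ^+ N.+1) M * poch (u * q ^+ N) M * poch (v * q ^+ N) M * poch (w / q ^+ N) M
  / (poch q M * poch u M * poch (v * q ^+ (2 * N)) M * poch w M).

Definition width_part N : F :=
  poch u N * poch (g / q ^+ N) N * poch (g / q ^+ N.+1) N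
  / (poch c N * poch (w / q ^+ N) N * poch (w / q ^+ N.+1) N) *
  (poch h (2 * N) / poch v (2 * N)) * kp ^+ N.

Definition closed_form N M := height_part N M * width_part N.

Lemma div_exprSl x (n : nat) : x / q ^+ n.+1 * q = x / q ^+ n.
Proof. by rewrite exprS; field; rewrite q_neq0 expf_neq0. Qed.

Lemma width_partS N : width_part N.+1 = width_part N * (
  th (u * q ^+ N) * th (h * q ^+ (2 * N).+1) * th (h * q ^+ (2 * N)) *
  th (g / q ^+ N.+1) * th (g / q ^+ N.+2) /
  (th (c * q ^+ N) * th (v * q ^+ (2 * N).+1) * th (v * q ^+ (2 * N)) *
   th (w / q ^+ N.+1) * th (w / q ^+ N.+2)) * kp).
Proof.
rewrite /width_part; have -> : (2 * N.+1 = (2 * N).+2)%N by lia.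
rewrite [poch u _]pochSr [poch c _]pochSr ![poch (_ / _) N.+1]pochSl !div_exprSl.
rewrite [poch h _]pochSr [poch h _]pochSr [poch v _]pochSr [poch v _]pochSr [kp ^+ _]exprSr.
rewrite !invfM.
move: (th (u * _)) (th (c * _)) (th (h * _)) (th (h * _)) (th (v * _)) (th (v * _))
  => y1 y2 y3 y4 y5 y6.
move: (th _) (th _) (th _) (th _) => y7 y8 y9 y10.
move: (poch _ _) (poch _ _) (poch _ _) (poch _ _) => x1 x2 x3 x4.
move: (poch _ _) (poch _ _) (poch _ _) (poch _ _) (kp ^+ N) => x5 x6 x7 x8 x9.
by ring.
Qed.

Lemma closed_form0n M : poch q M != 0 -> poch u M != 0 -> poch v M != 0 ->
  poch w M != 0 -> closed_form 0 M = 1.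
Proof.
move=> q0 u0 v0 w0; rewrite /closed_form /height_part /width_part !muln0 !poch0.
rewrite expr0 expr1 !mulr1 !divr1 divff ?mulf_neq0//.
by rewrite !mul1r.
Qed.

Lemma closed_formS0 N : closed_form N.+1 0 = closed_form N 0 * step_weight N 0.
Proof.
rewrite /closed_form /height_part /step_weight !poch0 !(muln0, addn0, expr0, mulr1).
by rewrite invr1 !mul1r width_partS.
Qed.

Lemma height_partSr N M : height_part N.+1 M.+1 = height_part N.+1 M * (
  th (q ^+ M.+1 * q ^+ N.+1) * th (u * q ^+ (M + N.+1)) * th (v * q ^+ (M + N.+1)) *
  th (w * q ^+ M / q ^+ N.+1) /
  (th (q ^+ M.+1) * th (u * q ^+ M) * th (v * q ^+ (2 * N + M).+2) * th (w * q ^+ M))).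
Proof.
rewrite /height_part !pochSr !invfM.
have -> : q ^+ N.+2 * q ^+ M = q ^+ M.+1 * q ^+ N.+1.
  by rewrite !exprSr; ring.
have -> : u * q ^+ N.+1 * q ^+ M = u * q ^+ (M + N.+1) by rewrite exprD; ring.
have -> : v * q ^+ N.+1 * q ^+ M = v * q ^+ (M + N.+1) by rewrite exprD; ring.
have -> : v * q ^+ (2 * N.+1) * q ^+ M = v * q ^+ (2 * N + M).+2.
  by rewrite -mulrA -exprD; congr (_ * _ ^+ _); lia.
have -> : w / q ^+ N.+1 * q ^+ M = w * q ^+ M / q ^+ N.+1 by rewrite mulrAC.
rewrite -exprS.
move: (th _) (th _) (th _) (th _) => y1 y2 y3 y4.
move: (th _) (th _) (th _) (th _) => y5 y6 y7 y8.
move: (poch _ _) (poch _ _) (poch _ _) (poch _ _) => x1 x2 x3 x4.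
move: (poch _ _) (poch _ _) (poch _ _) (poch _ _) => x5 x6 x7 x8.
by ring.
Qed.

(** Both recurrences relate to height_part N.+1 M, the common factor of the three
    terms of the recurrence. The telescoping cancellations between shifted
    factorials are where theta values have to be nonzero. *)
Lemma height_partSl N M :
  th (v * q ^+ (2 * N)) != 0 -> th (v * q ^+ (2 * N).+1) != 0 ->
  th (v * q ^+ (2 * N + M).+1) != 0 ->
  th (w / q ^+ N.+1) != 0 -> th (w * q ^+ M / q ^+ N.+1) != 0 ->
  height_part N M.+1 = height_part N.+1 M * (
  th (q ^+ N.+1) * th (u * q ^+ N) * th (v * q ^+ N) *
  ((th (w / q ^+ N.+1))^-1 * th (w * q ^+ M / q ^+ N.+1) * th (w * q ^+ M.+1 / q ^+ N.+1))
  / (th (q ^+ M.+1) * th (u * q ^+ M) *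
     (th (v * q ^+ (2 * N)) * th (v * q ^+ (2 * N).+1) / th (v * q ^+ (2 * N + M).+1))
     * th (w * q ^+ M))).
Proof.
move=> v1 v2 v3 w1 w2; rewrite /height_part.
have pv : poch (v * q ^+ (2 * N)) M.+1 = th (v * q ^+ (2 * N)) * th (v * q ^+ (2 * N).+1) *
    poch (v * q ^+ (2 * N.+1)) M / th (v * q ^+ (2 * N + M).+1).
  have shift n : v * q ^+ n * q = v * q ^+ n.+1 by rewrite -mulrA -exprSr.
  have := pochSr (v * q ^+ (2 * N)) M.+1; rewrite 2!pochSl !shift.
  have -> : v * q ^+ (2 * N) * q ^+ M.+1 = v * q ^+ (2 * N + M).+1.
    by rewrite -mulrA -exprD addnS.
  have -> : (2 * N.+1 = (2 * N).+2)%N by lia.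
  by move=> e; rewrite -[_ * _ * poch _ _]mulrA e mulfK.
have pw : poch (w / q ^+ N) M.+1 = th (w * q ^+ M.+1 / q ^+ N.+1) *
    (poch (w / q ^+ N.+1) M * th (w * q ^+ M / q ^+ N.+1) / th (w / q ^+ N.+1)).
  have e : th (w / q ^+ N.+1) * poch (w / q ^+ N) M =
      poch (w / q ^+ N.+1) M * th (w * q ^+ M / q ^+ N.+1).
    by rewrite -(div_exprSl w N) -pochSl pochSr [w / _ * _]mulrAC.
  rewrite -e [_ * poch _ _ / _]mulrAC divff// mul1r.
  rewrite pochSr mulrC; congr (th _ * _).
  by rewrite -(div_exprSl w N) !exprS; ring.
rewrite pv pw [poch (q ^+ _) _]pochSl [poch (u * _) _]pochSl.
rewrite [poch (v * q ^+ N) _]pochSl ![poch _ M.+1]pochSr -exprS -exprSr.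
have shift x n : x * q ^+ n * q = x * q ^+ n.+1 by rewrite -mulrA -exprSr.
rewrite !shift !invfM !invrK.
move: (th (u * q ^+ N)) (th (v * q ^+ N)) (th (q ^+ N.+1)) => y1 y2 y3.
move: (th (u * q ^+ M)) (th (w * q ^+ M)) (th (q ^+ M.+1)) => y4 y5 y6.
move: (th (v * _)) (th (v * _)) (th (v * _)) => y7 y8 y9.
move: (th _) (th _) (th _) => y10 y11 y12.
move: (poch _ _) (poch _ _) (poch _ _) (poch _ _) => x1 x2 x3 x4.
move: (poch _ _) (poch _ _) (poch _ _) (poch _ _) => x5 x6 x7 x8.
by ring.
Qed.

(** The nonvanishing conditions that the recurrence uses at all the points below
    (N, M); unlike those of the closed form at (N, M) alone, they are inherited by
    smaller N and M. *)
Definition generic_params N M :=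
  [/\ forall i, (i < M)%N ->
        [&& th (q ^+ i.+1) != 0, th (u * q ^+ i) != 0, th (v * q ^+ i) != 0 &
            th (w * q ^+ i) != 0] &
      forall i j, (i < N)%N -> (j <= M)%N ->
        [&& th (v * q ^+ (2 * i + j).+1) != 0, th (v * q ^+ (2 * i + j)) != 0,
            th (w * q ^+ j / q ^+ i.+1) != 0 & th (w * q ^+ j / q ^+ i.+2) != 0]].

(** After division by the common factor the recurrence is the three-term relation
    with e = q^(M + 1), f = q^(N + 1), s = v q^(M + N + 1), t = w q^M / q^(N + 1). *)
Lemma closed_formSS N M : generic_params N.+1 M.+1 ->
  closed_form N.+1 M.+1 = closed_form N M.+1 * step_weight N M.+1 + closed_form N.+1 M.
Proof.
have natE : (2 * N + M).+2 = (N.+1 + (M + N.+1))%N by lia.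
move=> [gM gNM].
have /and4P[qM uM _ wM] := gM M (ltnSn M).
have /and4P[] := gNM N 0%N (ltnSn N) (leq0n _); rewrite addn0 expr0 mulr1 => v1 v0 w1 w2.
have /and4P[v3 v2 w4 w3] := gNM N M.+1 (ltnSn N) (leqnn _); rewrite addnS in v3 v2.
have /and4P[_ _ w5 _] := gNM N M (ltnSn N) (leqnSn _).
have Wrel : th (q ^+ M.+1 * q ^+ N.+1) * th (u * q ^+ (M + N.+1)) *
    (th (v * q ^+ (M + N.+1)) * th (w * q ^+ M / q ^+ N.+1)) =
    th (q ^+ M.+1) * th (u * q ^+ M) *
    (th (v * q ^+ (2 * N + M).+2) * th (w * q ^+ M)) +
    q ^+ M.+1 * (th (q ^+ N.+1) * th (u * q ^+ (N + 2 * M.+1)) *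
    (th (v * q ^+ N) * th (w / q ^+ N.+2))).
  have qn n : q ^+ n != 0 by rewrite expf_neq0.
  have wE : w = u * q / v by rewrite -vw mulrAC divff ?mul1r.
  have := @weierstrass (q ^+ M.+1) (q ^+ N.+1) (v * q ^+ (M + N.+1))
    (w * q ^+ M / q ^+ N.+1); rewrite !mulf_neq0 ?invr_eq0// => /(_ (qn _) (qn _) isT isT).
  have -> : q ^+ N.+1 * (v * q ^+ (M + N.+1)) * (w * q ^+ M / q ^+ N.+1) / q ^+ M.+1
      = u * q ^+ (M + N.+1).
    by rewrite wE !(exprD, exprS); field; rewrite v_neq0 q_neq0 !qn.
  have -> : v * q ^+ (M + N.+1) * (w * q ^+ M / q ^+ N.+1) / q ^+ M.+1 = u * q ^+ M.
    by rewrite wE !(exprD, exprS); field; rewrite v_neq0 q_neq0 !qn.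
  have -> : q ^+ N.+1 * (v * q ^+ (M + N.+1)) * (w * q ^+ M / q ^+ N.+1) =
      u * q ^+ (N + 2 * M.+1).
    by rewrite wE mulnS mul2n -addnn !(exprD, exprS); field; rewrite v_neq0 q_neq0 !qn.
  have -> : q ^+ N.+1 * (v * q ^+ (M + N.+1)) = v * q ^+ (2 * N + M).+2.
    by rewrite natE [q ^+ (N.+1 + _)]exprD mulrCA.
  have -> : q ^+ N.+1 * (w * q ^+ M / q ^+ N.+1) = w * q ^+ M.
    by rewrite mulrC divfK.
  have -> : v * q ^+ (M + N.+1) / q ^+ M.+1 = v * q ^+ N.
    by rewrite addnS -addSn exprD; field; rewrite qn.
  have -> : w * q ^+ M / q ^+ N.+1 / q ^+ M.+1 = w / q ^+ N.+2.
    by rewrite !exprS; field; rewrite q_neq0 !qn.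
  by [].
rewrite /closed_form height_partSr (@height_partSl N M)// width_partS.
have w35 : w * q ^+ M.+1 / q ^+ N.+2 = w * q ^+ M / q ^+ N.+1.
  by rewrite !exprS; field; rewrite q_neq0 expf_neq0.
rewrite -[X in height_part _ _ * (X / _)]mulrA Wrel /step_weight w35 addnS.
(* Only the product structure matters from here on: all values become atoms. *)
move: v0 v1 v2 v3 w1 w2 w4 w5 qM uM wM {gM gNM w3 Wrel}.
move: (th (v * q ^+ (2 * N))) (th (v * q ^+ (2 * N).+1)) => y1 y2.
move: (th (v * q ^+ (2 * N + M).+1)) (th (v * q ^+ (2 * N + M).+2)) => y3 y4.
move: (th (w / q ^+ N.+1)) (th (w / q ^+ N.+2)) => y5 y6.
move: (th (w * q ^+ M.+1 / q ^+ N.+1)) (th (w * q ^+ M / q ^+ N.+1)) => y7 y8.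
move: (th (q ^+ M.+1)) (th (u * q ^+ M)) (th (w * q ^+ M)) => y9 y10 y11.
move: (height_part _ _) (width_part _) => H W.
move: (th (c * _)) (th (u * q ^+ (N + 2 * M.+1))) (th (u * _)) => y12 y13 y14.
move: (th (h * _)) (th (h * _)) (th (g / _)) (th (g / _)) => y15 y16 y17 y18.
move: (th _) (th _) (q ^+ M.+1) => y19 y20 e n1 n2 n3 n4 n5 n6 n7 n8 n9 n10 n11.
(* theta (c q^N) is a common denominator of all terms; if it vanishes, so do they. *)
have [->|n12] := eqVneq y12 0.
  by rewrite !(mul0r, invr0, mulr0, addr0).
by field; rewrite n1 n2 n3 n4 n5 n6 n7 n8 n9 n10 n11 n12.
Qed.

End ClosedForm.

(** * Comparison of the path sum with the closed form *)

Lemma mulf5_neq0 (F : fieldType) (x1 x2 x3 x4 x5 : F) : x1 * x2 * x3 * x4 * x5 != 0 ->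
  [&& x2 != 0, x3 != 0, x4 != 0 & x5 != 0].
Proof. by rewrite !mulf_eq0 !negb_or -!andbA => /and5P[_ -> -> -> ->]. Qed.

Section Assembly.
Local Opaque theta.
Variable C : numFieldType.
Variables a b q p : C.
Variables l k : int.
Hypotheses (a_neq0 : a != 0) (b_neq0 : b != 0) (q_neq0 : q != 0).
Hypothesis theta_p1 : theta p 1 = 0.
Hypothesis weierstrass : three_term_relation (theta p).

Let c := a * q ^ (1 + l).
Let h := b * q ^ (1 + 2 * l).
Let g := a * q ^ (1 - l) / b.
Let u := a * q ^ (1 + l + 2 * k).
Let v := b * q ^ (1 + k + 2 * l).
Let w := a * q ^ (1 + k - l) / b.

Lemma shift_expz (x : C) (i j : int) (n : nat) : i = j + n%:Z ->
  x * q ^ i = x * q ^ j * q ^+ n.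
Proof. by move=> ->; rewrite expfzDr// mulrA. Qed.

Lemma shift_expzV (i j : int) (n : nat) : i = j - n%:Z ->
  a * q ^ i / b = a * q ^ j / b / q ^+ n.
Proof. by move=> ->; rewrite expfzDr// -invr_expz mulrA mulrAC. Qed.

Lemma shift_expzDV (i j : int) (m n : nat) : i = j + m%:Z - n%:Z ->
  a * q ^ i / b = a * q ^ j / b * q ^+ m / q ^+ n.
Proof.
by move=> ->; rewrite !expfzDr// -invr_expz !mulrA mulrAC [_ * q ^ m / b]mulrAC.
Qed.

Lemma weight_denE (N M : nat) (x y : int) : x = l + N.+1%:Z -> y = k + M%:Z ->
  weight_den a b q p x y =
  theta p (c * q ^+ N) * theta p (v * q ^+ (2 * N + M).+1) *
  theta p (v * q ^+ (2 * N + M)) * theta p (w * q ^+ M / q ^+ N.+1) *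
  theta p (w * q ^+ M / q ^+ N.+2).
Proof.
move=> -> ->; rewrite /weight_den /thetas !big_cons big_nil mulr1 !mulrA.
set n := l + N.+1%:Z; set m := k + M%:Z.
rewrite (@shift_expz a n (1 + l) N); last by rewrite /n; lia.
rewrite (@shift_expz b (2 * n + m) (1 + k + 2 * l) (2 * N + M).+1); last by rewrite /n /m; lia.
rewrite (@shift_expz b (2 * n + m - 1) (1 + k + 2 * l) (2 * N + M)); last by rewrite /n /m; lia.
rewrite (@shift_expzDV (1 + m - n) (1 + k - l) M N.+1); last by rewrite /n /m; lia.
rewrite (@shift_expzDV (m - n) (1 + k - l) M N.+2); last by rewrite /n /m; lia.
by [].
Qed.

Lemma weight_step (N M : nat) (x y : int) : x = l + N.+1%:Z -> y = k + M%:Z ->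
  weight a b q p x y = step_weight (theta p) q c h g u v w (q ^ k) N M.
Proof.
move=> xE yE; rewrite /weight (weight_denE xE yE) /thetas !big_cons big_nil mulr1 !mulrA.
rewrite (@shift_expz a (x + 2 * y) (1 + l + 2 * k) (N + 2 * M)); last by rewrite xE yE; lia.
rewrite (@shift_expz b (2 * x) (1 + 2 * l) (2 * N).+1); last by rewrite xE; lia.
rewrite (@shift_expz b (2 * x - 1) (1 + 2 * l) (2 * N)); last by rewrite xE; lia.
rewrite (@shift_expzV (1 - x) (1 - l) N.+1); last by rewrite xE; lia.
rewrite (@shift_expzV (- x) (1 - l) N.+2); last by rewrite xE; lia.
rewrite yE.
by rewrite [q ^ (k + _)]expfzDr// /step_weight !mulrA.
Qed.

Let closed N M := closed_form (theta p) q c h g u v w (q ^ k) N M.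
Let gen N M := generic_params (theta p) q u v w N M.

Lemma generic_params_le N N' M M' : (N' <= N)%N -> (M' <= M)%N -> gen N M -> gen N' M'.
Proof.
move=> NN MM [gM gNM]; split=> [i iM|i j iN jM].
  by apply: gM; apply: leq_trans MM.
by apply: gNM; [apply: leq_trans NN|apply: leq_trans MM].
Qed.

(** Path sum and closed form satisfy the same recurrence with the same boundary
    values. *)
Lemma list_weight_closed_form N M : gen N M ->
  list_weight a b q p l k (N + M) (l + N%:Z, k + M%:Z) = closed N M.
Proof.
have v0 : v != 0 by rewrite mulf_neq0// expfz_neq0.
have w0 : w != 0 by rewrite !mulf_neq0 ?invr_eq0// expfz_neq0.
have vw : v * w = u * q.
  have -> : u * q = a * q ^ (1 + k - l) * q ^ (1 + k + 2 * l).
    by rewrite -mulrA -expfzDr// -mulrA -[q in LHS](expr1z q) -expfzDr//; congr (_ * q ^ _); lia.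
  by rewrite /v /w; field.
elim: N M => [|N IHN] M.
  elim: M => [|M IHM] gM.
    by rewrite addn0 !addr0 /closed closed_form0n ?poch0 ?oner_eq0//
      /list_weight /= eqxx big_seq1 /path_weight /= big_nil.
  rewrite add0n list_weightS /= list_weight_out ?mul0r ?add0r; last by left; rewrite /=; lia.
  have -> : k + M.+1%:Z - 1 = k + M%:Z by lia.
  have gM' : gen 0 M by apply: generic_params_le gM.
  rewrite -[M in list_weight _ _ _ _ _ _ M]add0n IHM//.
  have [g1 _] := gM; have [g2 _] := gM'.
  rewrite /closed !closed_form0n//; apply/poch_neq0P => i iM;
    rewrite -?exprS; by [have /and4P[] := g1 i iM|have /and4P[] := g2 i iM].
elim: M => [|M IHM] gM.
  have gM' : gen N 0 by apply: generic_params_le gM.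
  rewrite addn0 list_weightS /= [X in _ + X]list_weight_out ?addr0; last by right; rewrite /=; lia.
  rewrite (@weight_step N 0)//; last by rewrite addr0.
  have -> : l + N.+1%:Z - 1 = l + N%:Z by lia.
  have := IHN 0%N gM'; rewrite addn0 addr0 => ->.
  by rewrite /closed closed_formS0.
rewrite addSn list_weightS /= (@weight_step N M.+1)//.
have -> : l + N.+1%:Z - 1 = l + N%:Z by lia.
have -> : k + M.+1%:Z - 1 = k + M%:Z by lia.
rewrite IHN; last by apply: generic_params_le gM.
rewrite addnS -addSn IHM; last by apply: generic_params_le gM.
rewrite /closed (@closed_formSS _ _ _ c h g u v w (q ^ k) _ _ _ vw)//.
Qed.

Lemma tfact_poch x (n : nat) : tfact q p x n%:Z = poch (theta p) q x n.
Proof. by []. Qed.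

(** For m < k the closed form contains 1 / (q; q, p)_(m - k) = 0. *)
Lemma tfact_qV_eq0 j : (tfact q p q (Negz j))^-1 = 0.
Proof.
rewrite invrK; apply/eqP; rewrite prodf_seq_eq0; apply/hasP; exists j.
  by rewrite mem_index_iota ltnSn.
have -> : Negz j + j%:Z = -1 by rewrite NegzE; lia.
by rewrite exprN1 divff// theta_p1 eqxx.
Qed.

(** For n < l <= m - k + n the factor (q^(1 + n - l); q, p)_(m - k) contains
    theta(1) = 0. *)
Lemma tfact_vanish (j : nat) (x : int) : x <= 0 -> - x < j%:Z ->
  tfact q p (q ^ x) j%:Z = 0.
Proof.
move=> x0 xj; apply/eqP; rewrite tfact_poch prodf_seq_eq0; apply/hasP; exists (absz x).
  by rewrite mem_index_iota; lia.
have -> : q ^ x * q ^+ absz x = 1; last by rewrite theta_p1 eqxx.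
by rewrite -[q ^+ _]/(q ^ (absz x)%:Z) -expfzDr// (_ : x + _ = 0) ?expr0z//; lia.
Qed.

Lemma closed_form_tfacts (N M : nat) (n m : int) : n = l + N%:Z -> m = k + M%:Z ->
  tfacts q p [:: q ^ (1 + n - l); a * q ^ (1 + n + 2 * k);
                 b * q ^ (1 + n + k + l); a * q ^ (1 + k - n) / b] (m - k)
  / tfacts q p [:: q; a * q ^ (1 + l + 2 * k); b * q ^ (1 + 2 * n + k);
                   a * q ^ (1 + k - l) / b] (m - k)
  * (tfacts q p [:: a * q ^ (1 + l + 2 * k); a * q ^ (1 - n) / b;
                    a * q ^ (- n) / b] (n - l)
     / tfacts q p [:: a * q ^ (1 + l); a * q ^ (1 + k - n) / b;
                      a * q ^ (k - n) / b] (n - l))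
  * (tfact q p (b * q ^ (1 + 2 * l)) (2 * n - 2 * l)
     / tfact q p (b * q ^ (1 + k + 2 * l)) (2 * n - 2 * l))
  * q ^ ((n - l) * k) = closed N M.
Proof.
move=> nE mE; rewrite /tfacts !big_cons !big_nil !mulr1.
have -> : m - k = M%:Z by lia.
have -> : 2 * n - 2 * l = (2 * N)%N%:Z by lia.
have -> : n - l = N%:Z by lia.
have -> : q ^ (1 + n - l) = q ^+ N.+1.
  by rewrite -[RHS]/(q ^ N.+1%:Z); congr (q ^ _); lia.
rewrite (@shift_expz a (1 + n + 2 * k) (1 + l + 2 * k) N); last lia.
rewrite (@shift_expz b (1 + n + k + l) (1 + k + 2 * l) N); last lia.
rewrite (@shift_expz b (1 + 2 * n + k) (1 + k + 2 * l) (2 * N)); last lia.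
rewrite (@shift_expzV (1 + k - n) (1 + k - l) N); last lia.
rewrite (@shift_expzV (k - n) (1 + k - l) N.+1); last lia.
rewrite (@shift_expzV (1 - n) (1 - l) N); last lia.
rewrite (@shift_expzV (- n) (1 - l) N.+1); last lia.
have -> : q ^ (N%:Z * k) = (q ^ k) ^+ N.
  by rewrite mulrC -exprz_exp.
rewrite !tfact_poch /closed /closed_form /height_part /width_part -/u -/v -/w -/g -/c -/h.
by rewrite !mulrA.
Qed.

(** The weights of the edges supply all conditions except those on the factors of
    (q, u, w; q, p)_(m - k) and, when n = l and no edge is met, on those of
    (v; q, p)_(m - k). *)
Lemma generic_weights (N M : nat) (n m : int) : n = l + N%:Z -> m = k + M%:Z ->
  (forall x y : int, l < x <= n -> k <= y <= m -> weight_den a b q p x y != 0) ->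
  tfacts q p [:: q; a * q ^ (1 + l + 2 * k); b * q ^ (1 + 2 * n + k);
                 a * q ^ (1 + k - l) / b] (m - k) != 0 ->
  gen N M.
Proof.
move=> nE mE wden; have -> : m - k = M%:Z by lia.
rewrite /tfacts !big_cons big_nil mulr1 !mulf_eq0 !negb_or !tfact_poch.
move=> /and4P[/poch_neq0P q0 /poch_neq0P u0 /poch_neq0P v0 /poch_neq0P w0].
have gNM i j : (i < N)%N -> (j <= M)%N ->
    [&& theta p (v * q ^+ (2 * i + j).+1) != 0, theta p (v * q ^+ (2 * i + j)) != 0,
        theta p (w * q ^+ j / q ^+ i.+1) != 0 & theta p (w * q ^+ j / q ^+ i.+2) != 0].
  move=> iN jM; have xn : l < l + i.+1%:Z <= n by rewrite nE; apply/andP; split; lia.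
  have ym : k <= k + j%:Z <= m by rewrite mE; apply/andP; split; lia.
  have := wden _ _ xn ym; rewrite (@weight_denE i j)//; exact: mulf5_neq0.
have vM i : (i < M)%N -> theta p (v * q ^+ i) != 0.
  case: N nE gNM => [|N] nE gNM iM.
    have := v0 i iM; have -> : 1 + 2 * n + k = 1 + k + 2 * l by rewrite nE; lia.
    exact.
  by have /and4P[_ + _ _] := gNM 0%N i isT (ltnW iM); rewrite muln0 add0n.
split; last exact: gNM.
move=> i iM; apply/and4P; split; [|exact: u0|exact: vM|exact: w0].
by rewrite exprS; exact: q0.
Qed.

Lemma paths_weight_closed_form (n m : int) :
  (forall x y : int, l < x <= n -> k <= y <= m -> weight_den a b q p x y != 0) ->
  (0 <= m - k -> tfacts q p [:: q; a * q ^ (1 + l + 2 * k); b * q ^ (1 + 2 * n + k);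
                 a * q ^ (1 + k - l) / b] (m - k) != 0) ->
  0 <= n - l + m - k ->
  paths_weight a b q p (lattice_paths (l, k) (n, m)) =
  tfacts q p [:: q ^ (1 + n - l); a * q ^ (1 + n + 2 * k);
                 b * q ^ (1 + n + k + l); a * q ^ (1 + k - n) / b] (m - k)
  / tfacts q p [:: q; a * q ^ (1 + l + 2 * k); b * q ^ (1 + 2 * n + k);
                   a * q ^ (1 + k - l) / b] (m - k)
  * (tfacts q p [:: a * q ^ (1 + l + 2 * k); a * q ^ (1 - n) / b;
                    a * q ^ (- n) / b] (n - l)
     / tfacts q p [:: a * q ^ (1 + l); a * q ^ (1 + k - n) / b;
                      a * q ^ (k - n) / b] (n - l))
  * (tfact q p (b * q ^ (1 + 2 * l)) (2 * n - 2 * l)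
     / tfact q p (b * q ^ (1 + k + 2 * l)) (2 * n - 2 * l))
  * q ^ ((n - l) * k).
Proof.
move=> wden den1 nm; pose d := absz (n - l + m - k)%R.
have nmd : (n, m).1 - l + ((n, m).2 - k) = d%:Z by rewrite /= /d; lia.
rewrite (paths_weightE _ _ _ _ nmd).
have [mk|km] := ltrP m k.
  rewrite list_weight_out; last by right.
  have [j ->] : exists j, m - k = Negz j.
    by exists (absz (k - m - 1)%R); rewrite NegzE; lia.
  rewrite [X in _ = _ / X * _ * _ * _]/tfacts big_cons invfM tfact_qV_eq0.
  by rewrite !(mul0r, mulr0).
have [nl|ln] := ltrP n l.
  rewrite list_weight_out; last by left.
  have -> : m - k = (absz (m - k)%R)%:Z by lia.
  rewrite [X in _ = X / _ * _ * _ * _]/tfacts big_cons tfact_vanish ?mul0r//; lia.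
have nE : n = l + (absz (n - l)%R)%:Z by lia.
have mE : m = k + (absz (m - k)%R)%:Z by lia.
rewrite (closed_form_tfacts nE mE).
have -> : d = (absz (n - l)%R + absz (m - k)%R)%N by rewrite /d; lia.
rewrite {2}nE {2}mE list_weight_closed_form//.
apply: (generic_weights nE mE wden); apply: den1; lia.
Qed.

End Assembly.

Theorem theorem2p1 (R : realType) (a b q p : R[i]) (l k n m : int)
    (a_neq0 : a != 0) (b_neq0 : b != 0) (q_neq0 : q != 0) (p_lt1 : `|p| < 1)
    (* the denominators of the weights of the edges met by the paths *)
    (weight_den_neq0 : forall x y : int, l < x <= n -> k <= y <= m ->
       weight_den a b q p x y != 0)
    (* the denominators of the closed form *)
    (den1_neq0 : 0 <= m - k ->
       tfacts q p [:: q; a * q ^ (1 + l + 2 * k); b * q ^ (1 + 2 * n + k);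
                      a * q ^ (1 + k - l) / b] (m - k) != 0)
    (den2_neq0 : 0 <= n - l ->
       tfacts q p [:: a * q ^ (1 + l); a * q ^ (1 + k - n) / b;
                      a * q ^ (k - n) / b] (n - l) != 0)
    (den3_neq0 : 0 <= n - l ->
       tfact q p (b * q ^ (1 + k + 2 * l)) (2 * n - 2 * l) != 0)
    (steps_ge0 : 0 <= n - l + m - k) :
  paths_weight a b q p (lattice_paths (l, k) (n, m)) =
    tfacts q p [:: q ^ (1 + n - l); a * q ^ (1 + n + 2 * k);
                   b * q ^ (1 + n + k + l); a * q ^ (1 + k - n) / b] (m - k)
    / tfacts q p [:: q; a * q ^ (1 + l + 2 * k); b * q ^ (1 + 2 * n + k);
                     a * q ^ (1 + k - l) / b] (m - k)
    * (tfacts q p [:: a * q ^ (1 + l + 2 * k); a * q ^ (1 - n) / b;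
                      a * q ^ (- n) / b] (n - l)
       / tfacts q p [:: a * q ^ (1 + l); a * q ^ (1 + k - n) / b;
                        a * q ^ (k - n) / b] (n - l))
    * (tfact q p (b * q ^ (1 + 2 * l)) (2 * n - 2 * l)
       / tfact q p (b * q ^ (1 + k + 2 * l)) (2 * n - 2 * l))
    * q ^ ((n - l) * k).
Proof.
apply: paths_weight_closed_form => //.
  exact: (@theta1 _ p p_lt1).
exact: (@theta_weierstrass _ p p_lt1).
Qed.
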